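(* Let $R$ be a strictly local centrality measure, let $r\in\mathbb{R}$, and let $(G_n)_{n\ge 1}$ be a sequence of finite random (multi)graphs with $|V(G_n)|=n$. Let $K_n^r(R)$ be the number of connected components of the killed graph $G_n(R,r)$. (a) If $G_n$ converges locally in probability to $(G,o)\sim\mu$, then $$\frac{K_n^r(R)}{n}\ \longrightarrow\ \mathbb{E}_\mu\left[\frac{1}{|C_r(o)|}\right]\quad\text{in probability}.$$ (b) If $G_n$ converges locally weakly to $(\bar G,\bar o)\sim\bar\mu$, then $$\frac{\mathbb{E}[K_n^r(R)]}{n}\ \longrightarrow\ \mathbb{E}_{\bar\mu}\left[\frac{1}{|C_r(\bar o)|}\right].$$
   Context: All graphs are undirected, locally finite (multi)graphs. A rooted graph $(G,o)$ is a connected locally finite multigraph $G$ with a distinguished vertex $o$; for a possibly disconnected graph $G$ and a vertex $v$, $(G,v)$ means the connected component of $v$, rooted at $v$. $B_s^{(G)}(v)$ is the subgraph of $G$ spanned by the vertices at graph distance at most $s$ from $v$, rooted at $v$; $\cong$ is rooted isomorphism. $\mathscr{G}_\star$ is the space of rooted graphs up to rooted isomorphism, with metric $d((G_1,o_1),(G_2,o_2))=1/(R^\star+1)$, $R^\star=\sup\{s\ge 0: B_s^{(G_1)}(o_1)\cong B_s^{(G_2)}(o_2)\}$. Centrality: a centrality measure assigns to each graph $G$ a function $R: V(G)\to\mathbb{R}_{\ge0}$. It is strictly local if there is a fixed $N\in\mathbb{N}$ such that, for every $G$ and $v$, $R(v)$ depends on $G$ only through the rooted graph $B_N^{(G)}(v)$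 up to rooted isomorphism; it is then defined also on infinite locally finite graphs. Vertex removal: the $r$-killed graph $G(R,r)$ is obtained from $G$ by removing all vertices $v$ with $R(v)>r$ (the values $R(v)$ being computed in $G$), together with their incident edges. $C_r(o)$ is the connected component containing the root $o$ in the $r$-killed graph of the limit; $1/|C_r(o)|$ is interpreted as $0$ if $|C_r(o)|=\infty$ or if $o$ is removed. Local convergence: let $o_n$ be uniform on $V(G_n)$. $(G_n)$ converges locally weakly to $(\bar G,\bar o)\sim\bar\mu$ if $\mathbb{E}[f(G_n,o_n)]\to\mathbb{E}_{\bar\mu}[f(\bar G,\bar o)]$ for all bounded continuous $f:\mathscr{G}_\star\to\mathbb{R}$. $(G_n)$ converges locally in probability to $(G,o)\sim\mu$, where $\mu$ is a possibly random probability measure on $\mathscr{G}_\star$ (defined on the same probability space as the graphs if random), if for all $s>0$ and all rooted graphs $(H,o')$, $\frac1n\sum_{v\in V(G_n)}\mathbf{1}\{B_s^{(G_n)}(v)\cong(H,o')\}\to\mu(B_s^{(G)}(o)\cong(H,o'))$ in probability. *)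

(* Defs.v *)
From HB Require Import structures.
From mathcomp Require Import all_boot all_order all_algebra.
From mathcomp Require Import generic_quotient finmap.
From mathcomp Require Import all_classical all_reals all_analysis.

Set Implicit Arguments.
Unset Strict Implicit.
Unset Printing Implicit Defensive.

Import Order.TTheory GRing.Theory Num.Theory.
Import numFieldNormedType.Exports.

Local Open Scope classical_set_scope.
Local Open Scope ring_scope.

(** * Multigraphs *)

(* An undirected multigraph is given by its edge multiplicities: [mult v w] is
   the number of edges between [v] and [w], and [mult v v] the number of loops
   at [v].  Up to isomorphism this is the same as a vertex set with a set of
   edges and an incidence map.
   As quotients of types of graphs are used below, vertex types live in a
   universe strictly below that of the canonical structures: ['I_n] is not
   accepted as a vertex type, but its copy [{i : nat | (i < n)%N}] is. *)
Record graph := Graph {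
  vert : Type;
  mult : vert -> vert -> nat;
  mult_sym : forall v w, mult v w = mult w v;
  mult_locfin : forall v, finite_set [set w | (0 < mult v w)%N] }.

Arguments mult {g}.

(* The number of elements of a finite set ([0] for an infinite one). *)
Definition card_set (T : Type) (A : set T) : nat :=
  #|` fset_set (A : set {classic T})|%fset.

Definition adj (G : graph) : rel (vert G) := fun v w => (0 < mult v w)%N.

Definition connected_to (G : graph) (v w : vert G) : Prop :=
  exists p : seq (vert G), path (@adj G) v p /\ last v p = w.

(* The graph distance between [v] and [w] is at most [s]. *)
Definition dist_le (G : graph) (s : nat) (v w : vert G) : Prop :=
  exists p : seq (vert G),
    [/\ path (@adj G) v p, last v p = w & (size p <= s)%N].

Definition component (G : graph) (v : vert G) : set (vert G) :=
  [set w | connected_to v w].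

Definition n_components (G : graph) : nat :=
  card_set (range (@component G)).

Lemma sval_inj (T : Type) (A : set T) : injective (@proj1_sig T A).
Proof. by move=> [x Ax] [y Ay] /= xy; apply: eq_exist. Qed.

Lemma induced_locfin (G : graph) (A : set (vert G)) (v : {v | A v}) :
  finite_set [set w : {w | A w} | (0 < mult (sval v) (sval w))%N].
Proof.
apply: (@finite_preimage _ _ [set w | (0 < mult (sval v) w)%N]
  (@proj1_sig _ A)); first by move=> x y _ _; exact: sval_inj.
exact: mult_locfin.
Qed.

Definition induced (G : graph) (A : set (vert G)) : graph :=
  @Graph {v | A v} (fun v w => mult (sval v) (sval w))
    (fun v w => mult_sym (sval v) (sval w)) (@induced_locfin G A).

Definition giso (G H : graph) : Prop :=
  exists f : vert G -> vert H,
    bijective f /\ forall v w, mult (f v) (f w) = mult v w.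

(** * Rooted graphs *)

(* Not necessarily connected, unlike [rooted_graph]. *)
Record pgraph := PGraph { pg_graph :> graph; pg_root : vert pg_graph }.

Definition riso (G H : pgraph) : Prop :=
  exists f : vert G -> vert H,
    [/\ bijective f, f (pg_root G) = pg_root H
      & forall v w, mult (f v) (f w) = mult v w].

Record rooted_graph := RootedGraph {
  rg_pgraph :> pgraph;
  rg_connected : forall w, connected_to (pg_root rg_pgraph) w }.

Lemma dist_le_refl (G : graph) s (v : vert G) : dist_le s v v.
Proof. by exists [::]. Qed.

Definition ball_at (G : graph) (s : nat) (v : vert G) : pgraph :=
  @PGraph (induced (dist_le s v)) (exist _ v (dist_le_refl s v)).

Definition root_ball (s : nat) (G : pgraph) : pgraph := ball_at s (pg_root G).

Lemma component_refl (G : graph) (v : vert G) : component v v.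
Proof. by exists [::]. Qed.

Definition pcomponent (G : graph) (v : vert G) : pgraph :=
  @PGraph (induced (component v)) (exist _ v (component_refl v)).

Lemma path_lift (G : graph) (A : set (vert G)) (v : vert (induced A)) p :
  path (@adj G) (sval v) p -> all (mem A) p ->
  exists q : seq (vert (induced A)),
    map sval q = p /\ path (@adj (induced A)) v q.
Proof.
elim: p v => [|x p IH] v /=; first by exists [::].
move=> /andP[vx xp] /andP[/set_mem Ax Ap].
have [q [qp vq]] := IH (exist _ x Ax) xp Ap.
by exists (exist _ x Ax :: q); rewrite /= qp; split=> //; apply/andP; split.
Qed.

Lemma path_sval (G : graph) (A : set (vert G)) (v : vert (induced A)) q :
  path (@adj (induced A)) v q -> path (@adj G) (sval v) (map sval q).
Proof. by elim: q v => //= x q IH v /andP[vx /IH ->]; rewrite andbT. Qed.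

Lemma path_component (G : graph) (o v : vert G) p :
  component o v -> path (@adj G) v p -> all (mem (component o)) p.
Proof.
elim: p v => //= x p IH v [q [oq qv]] /andP[vx xp].
have ox : component o x.
  by exists (rcons q x); rewrite rcons_path oq last_rcons qv.
by apply/andP; split; [rewrite inE | exact: IH xp].
Qed.

Lemma path_ball (G : graph) (t k : nat) (o v : vert G) p :
  dist_le k o v -> path (@adj G) v p -> (k + size p <= t)%N ->
  all (mem (dist_le t o : set (vert G))) p.
Proof.
elim: p k v => //= x p IH k v [q [oq qv qk]] /andP[vx xp] kt.
have ox : dist_le k.+1 o x.
  by exists (rcons q x); rewrite rcons_path oq last_rcons qv size_rcons.
apply/andP; split; last by apply: IH ox xp _; rewrite addSnnS.
rewrite inE; case: ox => r [r1 r2 r3]; exists r; split=> //.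
by apply: leq_trans r3 (leq_trans _ kt); rewrite addnS ltnS leq_addr.
Qed.

Lemma pcomponent_connected (G : graph) (v : vert G) w :
  connected_to (pg_root (pcomponent v)) w.
Proof.
have [p [vp pw]] := svalP w.
have [q [qp vq]] := @path_lift G (component v) (pg_root (pcomponent v)) p vp
  (path_component (component_refl v) vp).
exists q; split=> //; apply: sval_inj.
rewrite -[RHS]pw -qp.
exact: esym (last_map sval q (pg_root (pcomponent v))).
Qed.

(* For a possibly disconnected [G], the rooted graph [(G, v)]. *)
Definition rooted (G : graph) (v : vert G) : rooted_graph :=
  @RootedGraph (pcomponent v) (@pcomponent_connected G v).

(** * The space of rooted graphs up to rooted isomorphism *)

Lemma riso_refl G : riso G G.
Proof. by exists id; split=> //; exists id. Qed.

Lemma riso_sym G H : riso G H -> riso H G.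
Proof.
move=> [f [[g fK gK] fr fm]]; exists g; split; first by exists f.
- by rewrite -fr fK.
- by move=> v w; rewrite -fm !gK.
Qed.

Lemma riso_trans G H K : riso G H -> riso H K -> riso G K.
Proof.
move=> [f [fb fr fm]] [g [gb gr gm]]; exists (g \o f); split.
- exact: bij_comp.
- by rewrite /= fr gr.
- by move=> v w; rewrite /= gm fm.
Qed.

Lemma dist_le_iso (G H : graph) s t (v : vert G) (w : vert H)
    (f : vert (ball_at t v) -> vert (ball_at t w)) :
  (s <= t)%N ->
  f (pg_root (ball_at t v)) = pg_root (ball_at t w) ->
  (forall x y, mult (f x) (f y) = mult x y) ->
  forall x, dist_le s v (sval x) -> dist_le s w (sval (f x)).
Proof.
move=> st fr fm x [p [vp px ps]].
have [|q [qp vq]] := @path_lift G _ (pg_root (ball_at t v)) p vp.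
  apply: (@path_ball G t 0 v v) vp _; first by exists [::].
  by rewrite add0n (leq_trans ps).
have qx : last (pg_root (ball_at t v)) q = x.
  apply: sval_inj; rewrite -px -qp.
  exact: esym (last_map sval q (pg_root (ball_at t v))).
exists (map sval (map f q)); split.
- have : path (@adj (ball_at t w)) (f (pg_root (ball_at t v))) (map f q).
    by rewrite path_map; apply: sub_path vq => y z; rewrite /= /adj fm.
  by move/path_sval; rewrite fr.
- rewrite -qx -(last_map f) fr.
  exact: (last_map sval (map f q) (pg_root (ball_at t w))).
- by rewrite !size_map -(size_map sval) qp.
Qed.

Lemma dist_le_leq (G : graph) s t (v w : vert G) :
  (s <= t)%N -> dist_le s v w -> dist_le t v w.
Proof.
by move=> st [p [p1 p2 p3]]; exists p; split=> //; exact: leq_trans st.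
Qed.

Lemma riso_ball_le (G H : pgraph) s t : (s <= t)%N ->
  riso (root_ball t G) (root_ball t H) -> riso (root_ball s G) (root_ball s H).
Proof.
move=> st [f [[g fK gK] fr fm]].
have gr : g (pg_root (root_ball t H)) = pg_root (root_ball t G).
  by rewrite -fr fK.
have gm x y : mult (g x) (g y) = mult x y by rewrite -fm !gK.
pose inc (K : pgraph) (x : vert (root_ball s K)) : vert (root_ball t K) :=
  exist _ (sval x) (dist_le_leq st (svalP x)).
pose fs (x : vert (root_ball s G)) : vert (root_ball s H) :=
  exist _ (sval (f (inc G x))) (dist_le_iso st fr fm (x := inc G x) (svalP x)).
pose gs (x : vert (root_ball s H)) : vert (root_ball s G) :=
  exist _ (sval (g (inc H x))) (dist_le_iso st gr gm (x := inc H x) (svalP x)).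
have incf x : inc H (fs x) = f (inc G x) by apply: sval_inj.
have incg x : inc G (gs x) = g (inc H x) by apply: sval_inj.
exists fs; split.
- exists gs => x; apply: sval_inj => /=; first by rewrite incf fK.
  by rewrite incg gK.
- apply: sval_inj => /=.
  have -> : inc G (pg_root (root_ball s G)) = pg_root (root_ball t G).
    exact: sval_inj.
  by rewrite fr.
- by move=> x y; exact: (fm (inc G x) (inc G y)).
Qed.

HB.instance Definition _ := gen_eqMixin rooted_graph.
HB.instance Definition _ := gen_choiceMixin rooted_graph.

Definition rooted_graph_iso : rel rooted_graph := fun G H => `[< riso G H >].

Lemma rooted_graph_iso_refl : reflexive rooted_graph_iso.
Proof. by move=> G; apply/asboolP; exact: riso_refl. Qed.

Lemma rooted_graph_iso_sym : symmetric rooted_graph_iso.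
Proof. by move=> G H; apply/asboolP/asboolP; exact: riso_sym. Qed.

Lemma rooted_graph_iso_trans : transitive rooted_graph_iso.
Proof.
by move=> G H K /asboolP HG /asboolP GK; apply/asboolP; exact: riso_trans GK.
Qed.

Canonical rooted_graph_equiv :=
  EquivRel rooted_graph_iso rooted_graph_iso_refl rooted_graph_iso_sym
    rooted_graph_iso_trans.

Lemma point_graph_locfin (v : unit) :
  finite_set [set w : unit | (0 < 0)%N].
Proof. by apply: (@sub_finite_set _ _ set0) => // w. Qed.

Definition point_pgraph : pgraph :=
  @PGraph (@Graph unit (fun _ _ => 0%N) (fun _ _ => erefl) point_graph_locfin)
    tt.

Lemma point_connected w : connected_to (pg_root point_pgraph) w.
Proof. by exists [::]; case: w. Qed.

Definition point_rooted_graph : rooted_graph := RootedGraph point_connected.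

(* The supremum of the radii of isomorphic balls; radii are natural numbers, as
   the graph distance is integer-valued, and the supremum is [0] when already
   the balls of radius [0] differ (different numbers of loops at the roots). *)
Definition agree_radius (R : realType) (G H : pgraph) : \bar R :=
  ereal_sup [set (s%:R)%:E | s in
    [set s : nat | s = 0%N \/ riso (root_ball s G) (root_ball s H)]].

Definition rg_dist (R : realType) (G H : pgraph) : R :=
  if agree_radius R G H == +oo%E then 0
  else (fine (agree_radius R G H) + 1)^-1.

(* The quotient does not depend on [R]; the parameter only fixes the field in
   which distances take their values. *)
Definition Gstar (R : realType) : Type := {eq_quot rooted_graph_iso}%qT.

HB.instance Definition _ (R : realType) :=
  Choice.copy (Gstar R) {eq_quot rooted_graph_iso}%qT.

Definition to_Gstar (R : realType) (G : rooted_graph) : Gstar R :=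
  \pi_({eq_quot rooted_graph_iso}%qT)%qT G.

Definition of_Gstar (R : realType) (g : Gstar R) : rooted_graph :=
  repr (g : {eq_quot rooted_graph_iso}%qT).

Definition Gstar_dist (R : realType) (g h : Gstar R) : R :=
  rg_dist R (of_Gstar g) (of_Gstar h).

Section metric.
Variable R : realType.

Lemma agree_radius_ge0 (G H : pgraph) : (0 <= agree_radius R G H)%E.
Proof. by apply: ereal_sup_ubound; exists 0%N => //; left. Qed.

Lemma agree_radius_sym (G H : pgraph) : agree_radius R G H = agree_radius R H G.
Proof.
congr ereal_sup; apply/seteqP; split=> _ [s sP <-]; exists s => //;
  by case: sP => sP; [left | right; exact: riso_sym].
Qed.

Lemma agree_radius_refl (G : pgraph) : agree_radius R G G = +oo%E.
Proof.
apply/eq_infty => x; apply: (@le_trans _ _ ((Num.truncn `|x|).+1%:R)%:E).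
  by rewrite lee_fin; apply: le_trans (ler_norm x) (ltW (truncnS_gt _)).
by apply: ereal_sup_ubound; exists (Num.truncn `|x|).+1 => //; right;
  exact: riso_refl.
Qed.

Lemma agree_radius_triangle (G H K : pgraph) :
  (agree_radius R G H <= agree_radius R G K)%E \/
  (agree_radius R H K <= agree_radius R G K)%E.
Proof.
apply: contrapT => /not_orP[/negP + /negP].
rewrite -!ltNge => /ereal_sup_gt[_ [s sP <-] lts] /ereal_sup_gt[_ [t tP <-] ltt].
have mP : minn s t = 0%N \/
    riso (root_ball (minn s t) G) (root_ball (minn s t) K).
  case: sP => [->|sP]; first by left; rewrite min0n.
  case: tP => [->|tP]; first by left; rewrite minn0.
  right; apply: (@riso_trans _ (root_ball (minn s t) H)).
  - exact: riso_ball_le (geq_minl _ _) sP.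
  - exact: riso_ball_le (geq_minr _ _) tP.
have : (((minn s t)%:R)%:E <= agree_radius R G K)%E.
  by apply: ereal_sup_ubound; exists (minn s t).
by rewrite leNgt; case: (leqP s t) => _; rewrite ?lts ?ltt.
Qed.

Lemma rg_dist_anti (G H G' H' : pgraph) :
  (agree_radius R G H <= agree_radius R G' H')%E ->
  rg_dist R G' H' <= rg_dist R G H.
Proof.
rewrite /rg_dist; have := agree_radius_ge0 G H; have := agree_radius_ge0 G' H'.
case: (agree_radius R G' H') => [b||]; case: (agree_radius R G H) => [a||] //=.
- rewrite !lee_fin => b0 a0 ab.
  by rewrite lef_pV2 ?posrE ?ltr_wpDl// lerD2r.
- by move=> _ a0 _; rewrite invr_ge0 addr_ge0.
Qed.

Lemma rg_dist_refl G : rg_dist R G G = 0.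
Proof. by rewrite /rg_dist agree_radius_refl eqxx. Qed.

Lemma rg_dist_ge0 G H : 0 <= rg_dist R G H.
Proof.
by rewrite -(rg_dist_refl G); apply: rg_dist_anti; rewrite agree_radius_refl leey.
Qed.

Definition Gstar_ball (g : Gstar R) (e : R) : set (Gstar R) :=
  [set h | Gstar_dist g h < e].

Lemma Gstar_ball_center g (e : R) : 0 < e -> Gstar_ball g e g.
Proof. by move=> e0; rewrite /Gstar_ball /= /Gstar_dist rg_dist_refl. Qed.

Lemma Gstar_ball_sym g h (e : R) : Gstar_ball g e h -> Gstar_ball h e g.
Proof. by rewrite /Gstar_ball /= /Gstar_dist /rg_dist agree_radius_sym. Qed.

Lemma Gstar_ball_triangle g h k (e1 e2 : R) :
  Gstar_ball g e1 h -> Gstar_ball h e2 k -> Gstar_ball g (e1 + e2) k.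
Proof.
rewrite /Gstar_ball /= /Gstar_dist => gh hk.
have [/rg_dist_anti le|/rg_dist_anti le] :=
    agree_radius_triangle (of_Gstar g) (of_Gstar h) (of_Gstar k);
  apply: le_lt_trans le _.
- by rewrite (lt_le_trans gh)// lerDl (le_trans _ (ltW hk))// rg_dist_ge0.
- by rewrite (lt_le_trans hk)// lerDr (le_trans _ (ltW gh))// rg_dist_ge0.
Qed.

End metric.

(* The distance separates points, but its topology only needs the pseudometric
   axioms. *)
HB.instance Definition _ (R : realType) :=
  isPointed.Build (Gstar R) (to_Gstar R point_rooted_graph).
HB.instance Definition _ (R : realType) :=
  hasNbhs.Build (Gstar R) (nbhs_ (entourage_ (@Gstar_ball R))).
HB.instance Definition _ (R : realType) :=
  Nbhs_isPseudoMetric.Build R (Gstar R) erefl (@Gstar_ball_center R)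
    (@Gstar_ball_sym R) (@Gstar_ball_triangle R) erefl.

Definition Gstar_borel (R : realType) := g_sigma_algebraType (@open (Gstar R)).

(** * Centralities and vertex removal *)

(* Centralities are defined on all locally finite graphs.  This loses nothing
   for strictly local ones: balls are finite graphs, so a strictly local
   centrality of finite graphs extends uniquely. *)
Record centrality (R : realType) := Centrality {
  cent :> forall G : graph, vert G -> R;
  cent_ge0 : forall (G : graph) (v : vert G), 0 <= cent v }.

Definition strictly_local (R : realType) (c : centrality R) : Prop :=
  exists N : nat, forall (G H : graph) (v : vert G) (w : vert H),
    riso (ball_at N v) (ball_at N w) -> c G v = c H w.

Definition killed (R : realType) (c : centrality R) (r : R) (G : graph) :
  graph := induced [set v : vert G | ~ (r < c G v)].

(* Empty when the root is removed. *)
Definition root_component (R : realType) (c : centrality R) (r : R)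
    (G : pgraph) : set (vert (killed c r G)) :=
  [set w | exists2 u : vert (killed c r G),
             sval u = pg_root G & connected_to u w].

Arguments root_component {R} c r G.

(* The inverse cardinality, with value [0] on infinite sets and on the empty
   set (removed root). *)
Definition inv_card (R : realType) (T : Type) (A : set T) : R :=
  if `[< finite_set A /\ A !=set0 >] then (card_set A)%:R^-1 else 0.

(* [1 / |C_r(o)|]; independent of the representative if [c] is strictly local. *)
Definition inv_root_component (R : realType) (c : centrality R) (r : R)
    (g : Gstar_borel R) : R :=
  inv_card R (root_component c r (@of_Gstar R g)).

(** * Random graphs and local convergence *)

(* A random multigraph on [n] vertices, seen up to isomorphism: nothing is
   assumed on how the vertex sets depend on the sample point. *)
Definition random_graph d (Om : measurableType d) (n : nat) (G : Om -> graph) :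
  Prop :=
  (forall w, [set: vert (G w)] #= `I_n)%card /\
  (forall H : graph, measurable [set w | giso (G w) H]).

(* The mean of [F] at a uniformly chosen vertex of the finite graph [G]. *)
Definition vertex_mean (R : realType) (G : graph) (F : vert G -> R) : R :=
  (card_set [set: vert G])%:R^-1 * \sum_(v \in [set: {classic vert G}]) F v.

Definition ball_frequency (R : realType) (s : nat) (H : pgraph) (G : graph) : R :=
  vertex_mean (fun v : vert G => (`[< riso (ball_at s v) H >])%:R).

Definition ball_event (R : realType) (s : nat) (H : pgraph) :
  set (Gstar_borel R) :=
  [set g | riso (root_ball s (@of_Gstar R g)) H].

(* [X n - Y n] tends to [0] in probability. *)
Definition cvg_in_probability (R : realType) (d : nat -> measure_display)
    (Om : forall n, measurableType (d n)) (P : forall n, probability (Om n) R)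
    (X Y : forall n, Om n -> R) : Prop :=
  forall e : R, 0 < e ->
    (fun n => P n [set w | e < `|X n w - Y n w|]) @ \oo --> 0%E.

(* The [n]-th graph and the limiting measure live on [Om n]; a non-random
   limit is a constant [mu]. *)
Definition local_cvg_in_probability (R : realType) (d : nat -> measure_display)
    (Om : forall n, measurableType (d n)) (P : forall n, probability (Om n) R)
    (G : forall n, Om n -> graph)
    (mu : forall n, Om n -> probability (Gstar_borel R) R) : Prop :=
  forall (s : nat) (H : rooted_graph), (0 < s)%N ->
    cvg_in_probability P
      (fun n w => ball_frequency R s H (G n w))
      (fun n w => fine (mu n w (@ball_event R s H))).

Definition local_weak_cvg (R : realType) (d : nat -> measure_display)
    (Om : forall n, measurableType (d n)) (P : forall n, probability (Om n) R)
    (G : forall n, Om n -> graph) (mu : probability (Gstar_borel R) R) : Prop :=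
  forall f : Gstar R -> R, continuous f -> (exists M, forall g, `|f g| <= M) ->
    (fun n => 'E_(P n)[fun w =>
       vertex_mean (fun v : vert (G n w) => f (to_Gstar R (rooted v)))]%E)
      @ \oo --> 'E_mu[(f : Gstar_borel R -> R)]%E.

(* Main.v *)
Require Import Defs.
From mathcomp Require Import all_boot all_order all_algebra.
From mathcomp Require Import finmap generic_quotient.
From mathcomp Require Import all_classical all_reals all_analysis.
From mathcomp Require Import measurable_realfun lra.

(** The number of components of a finite graph is the sum over its vertices of
    the inverse sizes of their components.  Hence [K_n / n] is the mean, over the
    vertices [v] of [G_n], of [f (G_n, v)], where [f (G, o) = 1 / |C_r(o)|]
    ([sum_inv_killed_component], [vertex_mean_inv_root_component]), and the
    theorem asserts that means of [f] converge to its expectation in the limit.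

    Although [f] may depend on the whole graph, it is bounded and uniformly
    continuous.  A ball of radius [m] in a component either is the whole
    component or has more than [m] vertices, so that the inverse sizes of the
    ball and of the component differ by at most [1 / (m + 1)].  As centralities
    depend on balls of a fixed radius [N], the ball of radius [m + N] of [G]
    determines the ball of radius [m] of the killed graph, and thereby [f] up to
    [2 / (m + 1)] ([inv_killed_component_local]).

    Local weak convergence then applies to [f] itself, which gives (b).

    For (a), let [s] be such that [f] varies by at most [e] among rooted graphs
    with isomorphic balls of radius [s].  There are countably many classes of
    such balls, as they are finite graphs ([nth_rooted_graph_ball]).  Up to [e]
    and the mass of the other classes, the average of [f] is a combination of the
    masses of the first [K] classes, both for the vertices of [G_n] and for the
    limit measure ([graph_average_dist]).  The first [K] frequencies converge in
    probability by hypothesis.  The mass of the other classes in the limit tends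
    to [0] as [K] grows, and does so in probability when the limit is random
    ([missed_tight]); their mass in [G_n] needs no separate argument, since total
    masses are [1].

    Events such as [K_n / n] lying in a Borel set are measurable because [G_n]
    takes countably many values up to isomorphism
    ([random_graph_measurable_set]). *)

Set Implicit Arguments.
Unset Strict Implicit.
Unset Printing Implicit Defensive.

Import Order.TTheory GRing.Theory Num.Theory.
Import numFieldNormedType.Exports.

Local Open Scope classical_set_scope.
Local Open Scope ring_scope.

(* The charge that a density induces goes by the same name. *)
Local Notation induced := Defs.induced.

(** * Graph distance and balls *)

Lemma dist_le0 (G : graph) (v w : vert G) : dist_le 0 v w -> w = v.
Proof. by case=> -[|x p] [] //= _ <-. Qed.

Lemma dist_leS (G : graph) s (v w : vert G) :
  dist_le s.+1 v w -> dist_le s v w \/ exists2 u, dist_le s v u & adj u w.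
Proof.
case=> p [+ + +]; case: (lastP p) => [|q x]; first by left; exists [::].
rewrite rcons_path last_rcons size_rcons => /andP[vq qx] <- qs.
by right; exists (last v q) => //; exists q.
Qed.

Lemma dist_le_adj (G : graph) s (v u w : vert G) :
  dist_le s v u -> adj u w -> dist_le s.+1 v w.
Proof.
move=> [p [vp <- ps]] uw; exists (rcons p w).
by rewrite rcons_path vp uw last_rcons size_rcons.
Qed.

Lemma dist_le_trans (G : graph) s t (u v w : vert G) :
  dist_le s u v -> dist_le t v w -> dist_le (s + t) u w.
Proof.
move=> [p [up <- ps]] [q [vq <- qt]]; exists (p ++ q).
by rewrite cat_path up vq last_cat size_cat leq_add.
Qed.

Lemma dist_le_component (G : graph) s (v w : vert G) :
  dist_le s v w -> component v w.
Proof. by move=> [p [vp pw _]]; exists p. Qed.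

Lemma dist_le_sval (G : graph) (A : set (vert G)) s (x y : vert (induced A)) :
  dist_le s x y -> dist_le s (sval x) (sval y).
Proof.
move=> [p [xp <- ps]]; exists (map sval p); split.
- exact: path_sval.
- exact: (last_map sval).
- by rewrite size_map.
Qed.

Lemma dist_le_induced (G : graph) (A : set (vert G)) s (x y : vert (induced A)) :
  (forall z, dist_le s (sval x) z -> A z) ->
  dist_le s (sval x) (sval y) -> dist_le s x y.
Proof.
move=> xA [p [xp py ps]].
have [q [qp xq]] : exists q : seq (vert (induced A)),
    map sval q = p /\ path (@adj (induced A)) x q.
  apply: path_lift => //.
  have := @path_ball G s 0 _ _ _ (dist_le_refl 0 (sval x)) xp ps.
  by apply: sub_all => z /set_mem /xA zA; rewrite inE.
exists q; split=> //; last by rewrite -(size_map sval) qp.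
by apply: sval_inj; rewrite -py -qp; exact: esym (last_map sval _ _).
Qed.

(** The paths that realise distances at most [s] from [x] stay in the ball, hence
    in [A], so removing the complement of [A] does not change the ball. *)
Lemma riso_ball_induced (G : graph) (A : set (vert G)) s
    (x : vert (induced A)) :
  (forall z, dist_le s (sval x) z -> A z) ->
  riso (ball_at s x) (ball_at s (sval x)).
Proof.
move=> xA.
pose f (y : vert (ball_at s x)) : vert (ball_at s (sval x)) :=
  exist _ (sval (sval y)) (dist_le_sval (svalP y)).
pose g0 (z : vert (ball_at s (sval x))) : vert (induced A) :=
  exist _ (sval z) (xA _ (svalP z)).
pose g (z : vert (ball_at s (sval x))) : vert (ball_at s x) :=
  exist _ (g0 z) (dist_le_induced (y := g0 z) xA (svalP z)).
exists f; split=> //; last exact: sval_inj.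
by exists g => y; do ![apply: sval_inj => //].
Qed.

Lemma riso_ball_mono (G H : graph) (f : vert G -> vert H) s (v : vert G) :
  bijective f -> (forall x y, mult (f x) (f y) = mult x y) ->
  riso (ball_at s v) (ball_at s (f v)).
Proof.
move=> [g fK gK] fm.
have gm x y : mult (g x) (g y) = mult x y by rewrite -fm !gK.
have fd x : dist_le s v x -> dist_le s (f v) (f x).
  move=> [p [vp <- ps]]; exists (map f p); split.
  - by rewrite path_map; apply: sub_path vp => a b; rewrite /= /adj fm.
  - exact: last_map.
  - by rewrite size_map.
have gd x : dist_le s (f v) x -> dist_le s v (g x).
  move=> [p [vp <- ps]]; exists (map g p); split.
  - rewrite -{1}(fK v) path_map; apply: sub_path vp => a b.
    by rewrite /= /adj gm.
  - by rewrite -{1}(fK v); exact: last_map.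
  - by rewrite size_map.
exists (fun x => exist _ (f (sval x)) (fd _ (svalP x))); split.
- exists (fun x => exist _ (g (sval x)) (gd _ (svalP x))) => x;
    by apply: sval_inj => /=; rewrite ?fK ?gK.
- exact: sval_inj.
- by move=> x y; exact: fm.
Qed.

Lemma riso_root_ball (G H : pgraph) s :
  riso G H -> riso (root_ball s G) (root_ball s H).
Proof.
by move=> [f [fb fr fm]]; rewrite /root_ball -fr; exact: riso_ball_mono.
Qed.

Lemma riso_ball_rooted (G : graph) s (v : vert G) :
  riso (root_ball s (rooted v)) (ball_at s v).
Proof. by apply: riso_ball_induced => x /=; exact: dist_le_component. Qed.

Section ball_iso.
Variables (G H : graph) (t : nat) (v : vert G) (w : vert H).
Variable f : vert (ball_at t v) -> vert (ball_at t w).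
Hypothesis fb : bijective f.
Hypothesis fr : f (pg_root (ball_at t v)) = pg_root (ball_at t w).
Hypothesis fm : forall x y, mult (f x) (f y) = mult x y.

(** A vertex at distance at most [m] from the root of a ball of radius [m + N]
    sees its own ball of radius [N] entirely inside: an isomorphism of the large
    balls therefore identifies the small balls, and with them the values of any
    function that depends on balls of radius [N] only. *)
Lemma riso_ball_inner m N (x : vert (ball_at t v)) :
  (m + N <= t)%N -> dist_le m v (sval x) ->
  riso (ball_at N (sval x)) (ball_at N (sval (f x))).
Proof.
move=> mNt vx.
have wx : dist_le m w (sval (f x)).
  by apply: dist_le_iso vx => //; exact: leq_trans (leq_addr _ _) mNt.
apply: (@riso_trans _ (ball_at N x)).
  apply: riso_sym; apply: riso_ball_induced => z xz.
  exact: dist_le_leq mNt (dist_le_trans vx xz).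
apply: (riso_trans (riso_ball_mono _ _ fb fm)).
apply: riso_ball_induced => z xz.
exact: dist_le_leq mNt (dist_le_trans wx xz).
Qed.

(** Paths within the kept vertices are carried, edge by edge, to such paths.  The
    image vertex is described by an equation because it lives in a subtype, with
    a proof of membership that only the induction provides. *)
Lemma kept_ball_map (A : set (vert G)) (B : set (vert H)) m
    (Av : A v) (Bw : B w) :
  (m <= t)%N ->
  (forall x, dist_le m v (sval x) -> A (sval x) -> B (sval (f x))) ->
  forall y : vert (induced A), dist_le m (exist _ v Av : vert (induced A)) y ->
    exists2 z : vert (induced B),
      dist_le m (exist _ w Bw : vert (induced B)) z &
      exists h, sval z = sval (f (exist _ (sval y) h)).
Proof.
elim: m => [|m IH] mt AB y vy.
  exists (exist _ w Bw); first exact: dist_le_refl.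
  rewrite (dist_le0 vy) /=; exists (dist_le_refl t v).
  by rewrite -[LHS]/(sval (pg_root (ball_at t w))) -fr.
have {}IH := IH (ltnW mt) (fun x vx => AB x (dist_le_leq (leqnSn m) vx)).
have [/IH[z wz zh]|[u vu uy]] := dist_leS vy.
  by exists z => //; exact: dist_le_leq wz.
have [z wz [h zh]] := IH _ vu.
have vy' := dist_le_sval vy.
have h' := dist_le_leq mt vy'.
have By := AB (exist _ (sval y) h') vy' (svalP y).
exists (exist _ _ By); last by exists h'.
apply: dist_le_adj wz _; rewrite /adj /= zh.
by have /= -> := fm (exist _ (sval u) h) (exist _ (sval y) h').
Qed.

End ball_iso.

(** If an isomorphism of balls respects which vertices are kept, it restricts to
    the balls of the graphs that remain after deletion.  These are balls for the
    distance after deletion, which may exceed the original one. *)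
Lemma riso_kept_ball (G H : graph) (t m : nat) (v : vert G) (w : vert H)
    (A : set (vert G)) (B : set (vert H)) (Av : A v) (Bw : B w)
    (f : vert (ball_at t v) -> vert (ball_at t w)) :
  bijective f -> f (pg_root (ball_at t v)) = pg_root (ball_at t w) ->
  (forall x y, mult (f x) (f y) = mult x y) ->
  (m <= t)%N ->
  (forall x, dist_le m v (sval x) -> A (sval x) <-> B (sval (f x))) ->
  riso (ball_at m (exist _ v Av : vert (induced A)))
       (ball_at m (exist _ w Bw : vert (induced B))).
Proof.
move=> [g fK gK] fr fm mt AB.
have gr : g (pg_root (ball_at t w)) = pg_root (ball_at t v) by rewrite -fr fK.
have gm x y : mult (g x) (g y) = mult x y by rewrite -fm !gK.
have fP := @kept_ball_map _ _ _ _ _ f fr fm A B m Av Bw mt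
  (fun x vx => (AB x vx).1).
have gP : forall y : vert (induced B),
    dist_le m (exist _ w Bw : vert (induced B)) y ->
    exists2 z : vert (induced A),
      dist_le m (exist _ v Av : vert (induced A)) z &
      exists h, sval z = sval (g (exist _ (sval y) h)).
  apply: kept_ball_map => // x wx Bx; apply/AB; last by rewrite gK.
  exact: dist_le_iso wx.
have fP' (y : vert (ball_at m (exist _ v Av : vert (induced A)))) :
    {z : vert (ball_at m (exist _ w Bw : vert (induced B))) |
      exists h, sval (sval z) = sval (f (exist _ (sval (sval y)) h))}.
  by apply: cid; have [z wz zh] := fP _ (svalP y); exists (exist _ z wz).
have gP' (y : vert (ball_at m (exist _ w Bw : vert (induced B)))) :
    {z : vert (ball_at m (exist _ v Av : vert (induced A))) |
      exists h, sval (sval z) = sval (g (exist _ (sval (sval y)) h))}.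
  by apply: cid; have [z wz zh] := gP _ (svalP y); exists (exist _ z wz).
exists (fun y => sval (fP' y)); split.
- exists (fun z => sval (gP' z)) => y; do 2 apply: sval_inj.
  + case: gP' => /= x [h ->]; move: h; case: fP' => /= z [h ->] h'.
    by rewrite (_ : exist _ _ h' = f (exist _ _ h)) ?fK//; exact: sval_inj.
  + case: fP' => /= x [h ->]; move: h; case: gP' => /= z [h ->] h'.
    by rewrite (_ : exist _ _ h' = g (exist _ _ h)) ?gK//; exact: sval_inj.
- do 2 apply: sval_inj; case: fP' => /= z [h ->].
  by rewrite (_ : exist _ _ h = pg_root (ball_at t v)) ?fr//; exact: sval_inj.
- move=> x y; case: (fP' x) (fP' y) => z [h zh] [z' [h' zh']] /=.
  by rewrite zh zh'; exact: fm.
Qed.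

(** * The inverse size of a component, up to a small error *)

Lemma card_set_eq (T U : Type) (A : set T) (B : set U) :
  (A #= B)%card -> card_set A = card_set B.
Proof.
move=> AB; have [finA|infA] := pselect (finite_set A).
  have finB : finite_set B by rewrite -(eq_finite_set AB).
  exact/(@fcard_eq {classic T} {classic U}).
have infB : ~ finite_set B by rewrite -(eq_finite_set AB).
by rewrite /card_set /fset_set; do 2 case: pselect => //.
Qed.

Lemma card_set_sub (T : Type) (A B : set T) :
  finite_set B -> A `<=` B -> (card_set A <= card_set B)%N.
Proof.
move=> finB AB; have finA := sub_finite_set AB finB.
by apply: fsubset_leq_card; rewrite -(@fset_set_sub {classic T} A B finA finB).
Qed.

Lemma card_set_ltn (T : Type) (A B : set T) (x : T) :
  finite_set B -> A `<=` B -> B x -> ~ A x -> (card_set A < card_set B)%N.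
Proof.
move=> finB AB Bx nAx; apply: fproper_ltn_card.
have finA := sub_finite_set AB finB.
rewrite fproperE; apply/andP; split.
  by rewrite -(@fset_set_sub {classic T} A B finA finB).
by apply/negP; rewrite -(@fset_set_sub {classic T} B A finB finA) => /(_ x Bx).
Qed.

Lemma card_set_gt0 (T : Type) (A : set T) :
  finite_set A -> A !=set0 -> (0 < card_set A)%N.
Proof.
move=> finA [x Ax]; rewrite cardfs_gt0; apply/fset0Pn; exists x.
by rewrite in_fset_set// inE.
Qed.

Lemma connected_to_sym (G : graph) (v w : vert G) :
  connected_to v w -> connected_to w v.
Proof.
move=> [p [vp <-]]; exists (rev (belast v p)); split.
  rewrite rev_path; apply: sub_path vp => x y; by rewrite /adj mult_sym.
by case: p {vp} => //= x p; rewrite rev_cons last_rcons.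
Qed.

Lemma connected_to_trans (G : graph) (u v w : vert G) :
  connected_to u v -> connected_to v w -> connected_to u w.
Proof.
move=> [p [up <-]] [q [vq <-]]; exists (p ++ q).
by rewrite cat_path up vq last_cat.
Qed.

Section inv_card.
Variable R : realType.

Lemma inv_card_eq (T U : Type) (A : set T) (B : set U) :
  (A #= B)%card -> inv_card R A = inv_card R B.
Proof.
move=> AB; rewrite /inv_card (card_set_eq AB) (eq_finite_set AB).
have -> // : (A !=set0) = (B !=set0).
apply/propext; rewrite -!set0P.
by rewrite -(card_eq0 (U := T)) (card_eql AB) card_eq0.
Qed.

Lemma inv_card_inj (T U : Type) (f : T -> U) (A : set T) :
  injective f -> inv_card R (f @` A) = inv_card R A.
Proof. by move=> fI; apply/inv_card_eq/inj_card_eq => x y _ _; exact: fI. Qed.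

Lemma inv_card_ge0 (T : Type) (A : set T) : 0 <= inv_card R A.
Proof. by rewrite /inv_card; case: asboolP => // _; rewrite invr_ge0. Qed.

Lemma inv_card_le (T : Type) (A : set T) m :
  (finite_set A -> (m < card_set A)%N) -> inv_card R A <= m.+1%:R^-1.
Proof.
rewrite /inv_card; case: asboolP => [[finA A0] /(_ finA) mA|_ _].
  by rewrite lef_pV2 ?posrE ?ltr0n ?ler_nat// (leq_trans _ mA).
by rewrite invr_ge0.
Qed.

Lemma inv_card_le1 (T : Type) (A : set T) : inv_card R A <= 1.
Proof.
have [A0|/set0P/negP/negPn/eqP ->] := pselect (A !=set0).
  rewrite -[leRHS]invr1; apply: (@inv_card_le _ A 0) => finA.
  exact: card_set_gt0.
by rewrite /inv_card asboolF// => -[_ []].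
Qed.

Lemma finite_dist_le (G : graph) s (v : vert G) : finite_set (dist_le s v).
Proof.
elim: s => [|s IH].
  by apply: (sub_finite_set _ (finite_set1 v)) => w /dist_le0 ->.
apply: (@sub_finite_set _ _ (dist_le s v `|`
  \bigcup_(u in (dist_le s v : set _)) [set w | (0 < mult u w)%N])).
  move=> w /dist_leS[sw|[u su uw]]; first by left.
  by right; exists u.
rewrite finite_setU; split=> //; apply: bigcup_finite => // u _.
exact: mult_locfin.
Qed.

(** Each sphere around [v] contributes a vertex until the component is
    exhausted. *)
Lemma component_or_card (G : graph) (v : vert G) m :
  component v `<=` (dist_le m v : set _) \/ (m < card_set (dist_le m v))%N.
Proof.
elim: m => [|m [IH|IH]].
- by right; apply: card_set_gt0 (finite_dist_le _ _) _; exists v; exists [::].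
- by left=> w /IH; exact: dist_le_leq.
have [sub|] := pselect ((dist_le m.+1 v : set _) `<=` dist_le m v).
  left=> w [p [vp <-]].
  suff : forall u, dist_le m v u -> path (@adj G) u p ->
      dist_le m.+1 v (last u p).
    by apply=> //; exact: dist_le_refl.
  elim: p {vp} => [|x p IHp] u mu /=; first by move=> _; exact: dist_le_leq mu.
  by move=> /andP[ux xp]; apply: IHp xp; apply: sub; exact: dist_le_adj ux.
move=> /existsNP[x /not_implyP[Sx nx]]; right; apply: leq_ltn_trans IH _.
apply: card_set_ltn Sx nx; first exact: finite_dist_le.
by move=> y; exact: dist_le_leq.
Qed.

(** Either the ball is the whole component, or both sets have more than [m]
    elements.  This is what makes the inverse size of a component visible from a
    bounded neighbourhood; an infinite component has inverse size [0]. *)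
Lemma inv_card_component_ball (G : graph) (v : vert G) m :
  `|inv_card R (component v) - inv_card R (dist_le m v)| <= m.+1%:R^-1.
Proof.
have ballC : (dist_le m v : set _) `<=` component v.
  by move=> w; exact: dist_le_component.
have [Cball|mball] := component_or_card v m.
  have -> : component v = dist_le m v by apply/seteqP.
  by rewrite subrr normr0 invr_ge0.
have le1 : inv_card R (component v) <= m.+1%:R^-1.
  by apply: inv_card_le => finC; exact: leq_trans mball (card_set_sub finC ballC).
have le2 : inv_card R (dist_le m v) <= m.+1%:R^-1 by exact: inv_card_le.
rewrite ler_distl (le_trans le1) ?lerDr ?inv_card_ge0// andbT lerBlDr.
by rewrite (le_trans le2)// lerDr inv_card_ge0.
Qed.

Lemma inv_card_ball_riso (G H : graph) (v : vert G) (w : vert H) m :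
  riso (ball_at m v) (ball_at m w) ->
  inv_card R (dist_le m v) = inv_card R (dist_le m w).
Proof.
move=> [f [fb _ _]].
have toT (K : graph) (x : vert K) :
    inv_card R (dist_le m x) = inv_card R [set: vert (ball_at m x)].
  rewrite -(inv_card_inj _ (@sval_inj _ (dist_le m x))); congr inv_card.
  apply/seteqP; split=> [y xy|_ [y _ <-]]; last exact: svalP.
  by exists (exist _ y xy).
rewrite !toT -(inv_card_inj _ (bij_inj fb)); congr inv_card.
by apply/seteqP; split=> // y _; have [g _ gK] := fb; exists (g y).
Qed.

Lemma inv_card_component_riso (G H : graph) (v : vert G) (w : vert H) m :
  riso (ball_at m v) (ball_at m w) ->
  `|inv_card R (component v) - inv_card R (component w)| <= 2 / m.+1%:R.
Proof.
move=> /inv_card_ball_riso e.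
have := inv_card_component_ball v m; have := inv_card_component_ball w m.
rewrite e mulr_natl mulr2n => ? ?.
by apply: le_trans (ler_distD (inv_card R (dist_le m w)) _ _) _;
  rewrite lerD// distrC.
Qed.

(** * Locality of the killed component *)

Section killed.
Variables (c : centrality R) (r : R).

(** The inverse size of a killed component at an arbitrary vertex of a possibly
    disconnected graph. *)
Definition inv_killed_component (G : graph) (v : vert G) : R :=
  inv_card R (root_component c r (PGraph v)).

Lemma inv_killed_component0 (G : graph) (v : vert G) :
  r < c G v -> inv_killed_component v = 0.
Proof.
move=> rv; rewrite /inv_killed_component /inv_card asboolF//.
move=> -[_ [w [u uv _]]].
by have := svalP u; rewrite /= uv.
Qed.

Lemma inv_killed_componentE (G : graph) (v : vert (killed c r G)) :
  inv_killed_component (sval v) = inv_card R (component v).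
Proof.
congr inv_card; apply/seteqP; split=> [w [u uv uw]|w vw]; last by exists v.
by rewrite -(sval_inj uv).
Qed.

(** A ball of radius [m + N] determines the centralities up to distance [m] from
    its root, hence the ball of radius [m] of the killed graph, hence the inverse
    size of the killed component up to [2 / (m + 1)]. *)
Lemma inv_killed_component_local N :
  (forall (G H : graph) (v : vert G) (w : vert H),
    riso (ball_at N v) (ball_at N w) -> c G v = c H w) ->
  forall m (G H : graph) (v : vert G) (w : vert H),
    riso (ball_at (m + N) v) (ball_at (m + N) w) ->
    `|inv_killed_component v - inv_killed_component w| <= 2 / m.+1%:R.
Proof.
move=> cN m G H v w [f [fb fr fm]].
have cf x : dist_le m v (sval x) -> c G (sval x) = c H (sval (f x)).
  by move=> vx; apply: cN; exact: (riso_ball_inner fb fr fm (leqnn _) vx).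
have cvw : c G v = c H w.
  by have := cf (pg_root (ball_at (m + N) v)); rewrite fr; apply; exists [::].
have [rv|rv] := pselect (r < c G v).
  rewrite !inv_killed_component0 -?cvw// subrr normr0.
  by rewrite divr_ge0.
have rw : ~ r < c H w by rewrite -cvw.
rewrite (@inv_killed_componentE G (exist _ v rv)).
rewrite (@inv_killed_componentE H (exist _ w rw)).
apply: inv_card_component_riso; apply: riso_kept_ball fb fr fm (leq_addr _ _) _.
by move=> x vx; rewrite /= (cf x vx).
Qed.

End killed.

(** * Components counted by their vertices *)

Lemma component_eq (G : graph) (v w : vert G) :
  component v w -> component w = component v.
Proof.
move=> vw; apply/seteqP; split=> u.
  by apply: connected_to_trans.
by apply: connected_to_trans; exact: connected_to_sym.
Qed.

(** The vertices of a component of size [k] contribute [k] times [1 / k]. *)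
Lemma sum_inv_component (G : graph) : finite_set [set: vert G] ->
  \sum_(v \in [set: {classic vert G}]) inv_card R (component v) =
  (n_components G)%:R.
Proof.
move=> finG.
have finC (v : vert G) : finite_set (component v) by exact: sub_finite_set finG.
rewrite fsbig_finite//=.
pose h (v : {classic vert G}) : {classic set (vert G)} := component v.
rewrite (partition_big_imfset _ h) /n_components /card_set.
have -> : fset_set (range (@component G) : set {classic set (vert G)}) =
    [fset h x | x in fset_set [set: {classic vert G}]]%fset.
  exact: (@fset_set_image {classic vert G} {classic set (vert G)} h).
set A := [fset h x | x in _]%fset; have -> : (#|` A|%:R : R) = \sum_(j <- A) 1.
  by rewrite -sum1_size natr_sum.
apply: eq_big_seq => C /imfsetP[v _ ->] /=.
transitivity (\sum_(i <- fset_set (component v : set {classic vert G}))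
    inv_card R (component v)).
  rewrite big_fset_condE.
  have -> : [fset i in fset_set [set: {classic vert G}] | h i == h v]%fset =
      fset_set (component v : set {classic vert G}).
    apply/fsetP => w; rewrite !inE in_fset_set// in_fset_set//= in_setT /=.
    apply/eqP/idP => [e|].
      by rewrite inE -[component v]/(h v) -e; exact: component_refl.
    by move=> /set_mem vw; exact: component_eq.
  rewrite !big_seq; apply: eq_bigr => w; rewrite in_fset_set// => /set_mem vw.
  by rewrite (component_eq vw).
rewrite /inv_card asboolT; last by split=> //; exists v; exact: component_refl.
rewrite big_const_seq count_predT iter_addr_0 -[LHS]mulr_natl.
rewrite -[#|` _|]/(card_set (component v)) mulfV// pnatr_eq0 -lt0n.
by apply: card_set_gt0 => //; exists v; exact: component_refl.
Qed.

Lemma sum_inv_killed_component (c : centrality R) (r : R) (G : graph) :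
  finite_set [set: vert G] ->
  \sum_(v \in [set: {classic vert G}]) inv_killed_component c r v =
  (n_components (killed c r G))%:R.
Proof.
move=> finG; rewrite -sum_inv_component; last first.
  by apply: (finite_preimage (f := sval) _ finG) => x y _ _; exact: sval_inj.
under [RHS]eq_fsbigr do rewrite -inv_killed_componentE.
rewrite -(fsbig_image [set: {classic vert (killed c r G)}]
  (@proj1_sig _ _ : {classic vert (killed c r G)} -> {classic vert G})
  (@inv_killed_component c r G)); last by move=> x y _ _; exact: sval_inj.
apply/esym/fsbig_widen => // v [_ nv]; apply: inv_killed_component0.
by apply: contra_notP nv => rv; exists (exist _ v rv).
Qed.

End inv_card.

(** * Finite graphs up to isomorphism are countable *)

Lemma finite_ord (n : nat) : finite_set [set: {i : nat | (i < n)%N}].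
Proof.
have : finite_set (@proj1_sig nat (fun i => (i < n)%N : Prop) @^-1` `I_n).
  by apply: finite_preimage (finite_II n) => x y _ _; exact: sval_inj.
by apply: sub_finite_set => -[i iltn] _.
Qed.

Section code_graph.
Variables (n : nat) (s : seq (seq nat)).

Let code_mult (v w : {i : nat | (i < n)%N}) : nat :=
  nth 0 (nth [::] s (minn (sval v) (sval w))) (maxn (sval v) (sval w)).

Let code_mult_sym v w : code_mult v w = code_mult w v.
Proof. by rewrite /code_mult minnC maxnC. Qed.

Let code_locfin v : finite_set [set w | (0 < code_mult v w)%N].
Proof. exact: sub_finite_set (finite_ord n). Qed.

Definition code_graph : graph := Graph code_mult_sym code_locfin.

End code_graph.

(** A numbering of the vertices turns a graph into its table of multiplicities. *)
Lemma code_graph_giso (G : graph) n : ([set: vert G] #= `I_n)%card ->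
  exists s, giso G (code_graph n s).
Proof.
move=> /card_set_bijP[f [fT fI fS]].
(* A choice of vertices is needed, as [f] is invertible on its image only. *)
pose m i j :=
  xget 0%N [set k | exists v w, [/\ f v = i, f w = j & mult v w = k]].
have mE v w : m (f v) (f w) = mult v w.
  rewrite /m; apply: xget_unique; first by exists v, w.
  move=> k [v' [w' [vv' ww' <-]]].
  by rewrite (fI _ _ _ _ vv') ?inE// (fI _ _ _ _ ww') ?inE.
pose s := [seq [seq m i j | j <- iota 0 n] | i <- iota 0 n].
have sE v w : nth 0%N (nth [::] s (f v)) (f w) = mult v w.
  have := fT v I; have := fT w I => /= wn vn.
  rewrite (nth_map 0%N) ?size_iota// (nth_map 0%N) ?size_iota//.
  by rewrite !nth_iota ?add0n.
pose e v : {i : nat | (i < n)%N} := exist _ (f v) (fT v I).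
exists s, e; split.
  rewrite -setTT_bijective; split=> //.
    by move=> v w _ _ [] /fI; apply; rewrite inE.
  move=> [i iltn] _; have [v _ vi] := fS i iltn; exists v => //.
  exact: sval_inj.
move=> v w; rewrite /= /minn /maxn; case: (ltnP (f v) (f w)) => _; rewrite sE//.
exact: mult_sym.
Qed.

Definition nth_graph (i : nat) : graph :=
  if (choice.unpickle i : option (nat * seq (seq nat))) is Some (n, s)
  then code_graph n s else code_graph 0 [::].

Lemma nth_graph_giso (G : graph) n : ([set: vert G] #= `I_n)%card ->
  exists i, giso G (nth_graph i).
Proof.
move=> /code_graph_giso[s Gs].
by exists (choice.pickle (n, s)); rewrite /nth_graph choice.pickleK.
Qed.

(** The component of the root is taken so that the result is connected for every
    table. *)
Definition code_rooted_graph (n : nat) (s : seq (seq nat)) (k : nat) :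
    rooted_graph :=
  if insub k is Some v
  then @rooted (code_graph n s) (v : {i : nat | (i < n)%N})
  else point_rooted_graph.

Definition nth_rooted_graph (i : nat) : rooted_graph :=
  if (choice.unpickle i : option (nat * seq (seq nat) * nat)) is Some (n, s, k)
  then code_rooted_graph n s k else point_rooted_graph.

Lemma riso_rooted (G : pgraph) : (forall w, connected_to (pg_root G) w) ->
  riso (rooted (pg_root G)) G.
Proof.
move=> Gc; exists sval; split=> //.
by exists (fun v => exist _ v (Gc v)) => v //; exact: sval_inj.
Qed.

Lemma connected_to_mono (G H : graph) (f : vert G -> vert H) (v w : vert G) :
  (forall x y, mult (f x) (f y) = mult x y) ->
  connected_to v w -> connected_to (f v) (f w).
Proof.
move=> fm [p [vp <-]]; exists (map f p); split; last exact: last_map.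
by rewrite path_map; apply: sub_path vp => a b; rewrite /= /adj fm.
Qed.

Lemma nth_rooted_graph_riso (G : pgraph) : finite_set [set: vert G] ->
  (forall w, connected_to (pg_root G) w) ->
  exists i, riso G (nth_rooted_graph i).
Proof.
move=> /finite_setP[n /code_graph_giso[s [f [[g fK gK] fm]]]] Gc.
pose k : {i : nat | (i < n)%N} := f (pg_root G).
exists (choice.pickle (n, s, sval k)); rewrite /nth_rooted_graph choice.pickleK.
rewrite /code_rooted_graph -[sval k]/(val k) valK.
pose C := @PGraph (code_graph n s) k.
apply: (@riso_trans _ C).
  by exists f; split=> //; exists g.
apply: riso_sym; apply: (@riso_rooted C) => w.
by rewrite -(gK w); exact: connected_to_mono.
Qed.

Lemma nth_rooted_graph_ball (G : graph) s (v : vert G) :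
  exists i, riso (ball_at s v) (nth_rooted_graph i).
Proof.
apply: nth_rooted_graph_riso.
  have := @finite_preimage _ _ _ (@proj1_sig _ (dist_le s v))
    (fun x y _ _ => @sval_inj _ _ x y) (finite_dist_le s v).
  by apply: sub_finite_set => -[].
move=> w; apply: (@dist_le_component _ s).
by apply: dist_le_induced => //; exact: svalP.
Qed.

(** * Isomorphism invariants of random graphs are measurable *)

Section invariant.
Context d (Om : measurableType d) (n : nat) (G : Om -> graph).
Hypothesis Grandom : random_graph n G.

(** There are only countably many isomorphism classes to take the union over. *)
Lemma random_graph_measurable_set (Q : graph -> Prop) :
  (forall H K, giso H K -> Q H <-> Q K) -> measurable [set w | Q (G w)].
Proof.
move=> QHK; have [Gn Gm] := Grandom.
have -> : [set w | Q (G w)] = \bigcup_(i in [set i | Q (nth_graph i)])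
    [set w | giso (G w) (nth_graph i)].
  apply/seteqP; split=> [w Qw|w [i Qi wi]]; last exact/(QHK _ _ wi).
  by have [i wi] := nth_graph_giso (Gn w); exists i => //; exact/(QHK _ _ wi).
by apply: bigcup_measurable => i _; exact: Gm.
Qed.

Lemma random_graph_card w : card_set [set: vert (G w)] = n.
Proof. exact: (@card_fset_set {classic vert (G w)} _ _ (Grandom.1 w)). Qed.

Lemma random_graph_finite w : finite_set [set: vert (G w)].
Proof. by apply/finite_setP; exists n; exact: (Grandom.1 w). Qed.

Lemma vertex_mean_giso (R : realType) (F : forall H : graph, vert H -> R)
    (H K : graph) :
  (forall H K (v : vert H) (w : vert K),
     riso (PGraph v) (PGraph w) -> F H v = F K w) ->
  giso H K -> vertex_mean (F H) = vertex_mean (F K).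
Proof.
move=> FHK [f [fb fm]]; have [g fK gK] := fb; congr (_%:R^-1 * _).
  apply: card_set_eq.
  have := @inj_card_eq _ _ setT f (fun x y _ _ => @can_inj _ _ _ _ fK x y).
  rewrite card_eq_sym (_ : f @` setT = setT)//.
  by apply/seteqP; split=> // y _; exists (g y).
rewrite (@reindex_fsbigT _ _ _ {classic vert H} {classic vert K} f (F K))//.
by apply: eq_fsbigr => v _; apply: FHK; exists f.
Qed.

Lemma measurable_vertex_mean (R : realType) (F : forall H : graph, vert H -> R) :
  (forall H K (v : vert H) (w : vert K),
     riso (PGraph v) (PGraph w) -> F H v = F K w) ->
  measurable_fun setT (fun w => vertex_mean (F (G w))).
Proof.
move=> FHK _ Y mY; rewrite setTI.
by apply: (random_graph_measurable_set (Q := fun H => Y (vertex_mean (F H)))) =>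
  H K HK; rewrite (vertex_mean_giso FHK HK).
Qed.

End invariant.

(** * The topology of the space of rooted graphs *)

Section Gstar.
Variable R : realType.

Lemma of_Gstar_to_Gstar (G : rooted_graph) : riso (of_Gstar (to_Gstar R G)) G.
Proof.
have : \pi_({eq_quot rooted_graph_iso}%qT)%qT (of_Gstar (to_Gstar R G)) =
    \pi_({eq_quot rooted_graph_iso}%qT)%qT G by rewrite /of_Gstar reprK.
by move=> /eqmodP /asboolP.
Qed.

Lemma rg_dist_riso (G H : pgraph) s : rg_dist R G H < s.+1%:R^-1 ->
  riso (root_ball s G) (root_ball s H).
Proof.
move=> GH; have : ((s%:R)%:E < agree_radius R G H)%E.
  move: GH; rewrite /rg_dist; have := agree_radius_ge0 R G H.
  case: agree_radius => [a||]//=; last by rewrite ltry.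
  rewrite lee_fin lte_fin => a0.
  have a1 : 0 < a + 1 by rewrite ltr_wpDl.
  by rewrite ltf_pV2 ?posrE// -natr1 ltrD2r.
move=> /ereal_sup_gt[_ [t [->|tP] <-]]; first by rewrite lte_fin ltr_nat.
by rewrite lte_fin ltr_nat => /ltnW st; exact: riso_ball_le tP.
Qed.

(** Agreement with [g] up to a given radius is an open and closed condition, which
    is why functions of a bounded ball are continuous. *)
Lemma nbhs_agree (g : Gstar R) s :
  nbhs g [set h | riso (root_ball s (of_Gstar g)) (root_ball s (of_Gstar h))].
Proof.
apply/nbhs_ballP; exists (s.+1%:R^-1) => /=; first by rewrite invr_gt0.
by move=> h; exact: rg_dist_riso.
Qed.

(** Uniform continuity for the distance of the space of rooted graphs. *)
Definition uniformly_local (f : Gstar R -> R) : Prop :=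
  forall e, 0 < e -> exists s, forall g h,
    riso (root_ball s (of_Gstar g)) (root_ball s (of_Gstar h)) ->
    `|f g - f h| <= e.

Lemma uniformly_local_continuous f : uniformly_local f -> continuous f.
Proof.
move=> fl g; apply/(@cvgrPdist_le _ _ _ (nbhs g) (nbhs_filter g)) => e e0.
have [s fs] := fl e e0.
apply: (@filterS _ (nbhs g) _ _ _ _ (nbhs_agree g s)) => h.
exact: fs.
Qed.

Lemma measurable_open (A : set (Gstar R)) :
  open A -> measurable (A : set (Gstar_borel R)).
Proof. exact: sub_sigma_algebra. Qed.

Lemma measurable_ball_event s (H : pgraph) : measurable (@ball_event R s H).
Proof.
apply: measurable_open; rewrite openE => g gH.
rewrite /interior; apply: filterS (nbhs_agree g s) => h gh.
exact: riso_trans (riso_sym gh) gH.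
Qed.

Lemma measurable_continuous (f : Gstar R -> R) : continuous f ->
  measurable_fun setT (f : Gstar_borel R -> R).
Proof.
move=> fc; apply: (measurability _ (RGenOpens.measurableE R)).
move=> _ [_ [a [b ->]] <-].
rewrite setTI; apply: measurable_open; apply: open_comp => // x _; exact: fc.
Qed.

Lemma riso_ball_to_Gstar (G : graph) s (v : vert G) :
  riso (root_ball s (of_Gstar (to_Gstar R (rooted v)))) (ball_at s v).
Proof.
apply: riso_trans (riso_ball_rooted s v).
exact/riso_root_ball/of_Gstar_to_Gstar.
Qed.

Lemma ball_eventP s (H : pgraph) (G : graph) (v : vert G) :
  ball_event s H (to_Gstar R (rooted v)) <-> riso (ball_at s v) H.
Proof.
have e := riso_ball_to_Gstar s v.
by split; apply: riso_trans; [exact: riso_sym|].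
Qed.

Lemma small_bound (e : R) : 0 < e -> exists m : nat, 2 / m.+1%:R < e.
Proof.
move=> e0; exists (Num.truncn (2 / e)).
by rewrite ltr_pdivrMr// mulrC -ltr_pdivrMr//; exact: truncnS_gt.
Qed.

Lemma uniformly_local_eq (f : Gstar R -> R) (g h : Gstar R) :
  uniformly_local f ->
  (forall s, riso (root_ball s (of_Gstar g)) (root_ball s (of_Gstar h))) ->
  f g = f h.
Proof.
move=> fl gh; apply/eqP; rewrite -subr_eq0 -normr_le0.
by apply/ler_addgt0Pl => e e0; rewrite addr0; have [s] := fl e e0; apply.
Qed.

Section inv_root_component.
Variables (c : centrality R) (r : R).
Hypothesis c_local : strictly_local c.

Lemma uniformly_local_inv_root_component :
  uniformly_local (inv_root_component c r).
Proof.
move=> e /small_bound[m /ltW me]; have [N cN] := c_local.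
exists (m + N)%N => g h gh; apply: le_trans me.
exact: (@inv_killed_component_local R c r N cN).
Qed.

Lemma inv_root_component_rooted (G : graph) (v : vert G) :
  inv_root_component c r (to_Gstar R (rooted v)) = inv_killed_component c r v.
Proof.
have [N cN] := c_local; apply/eqP; rewrite -subr_eq0 -normr_le0.
apply/ler_addgt0Pl => e /small_bound[m /ltW me]; rewrite addr0.
apply: le_trans me; apply: (@inv_killed_component_local R c r N cN).
exact: riso_ball_to_Gstar.
Qed.

Lemma vertex_mean_inv_root_component (G : graph) :
  finite_set [set: vert G] ->
  vertex_mean (fun v : vert G =>
    inv_root_component c r (to_Gstar R (rooted v))) =
  (n_components (killed c r G))%:R / (card_set [set: vert G])%:R.
Proof.
move=> finG; rewrite mulrC -sum_inv_killed_component//; congr (_ * _).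
by apply: eq_fsbigr => v _; exact: inv_root_component_rooted.
Qed.

End inv_root_component.

End Gstar.

(** * Averages of uniformly local functions *)

Section averages.
Variable R : realType.

Definition ball_class s i : set (Gstar_borel R) :=
  @ball_event R s (nth_rooted_graph i).

(** The list of rooted graphs has repetitions, and only the first representative
    of each isomorphism class gets weight [1], so that the weighted ball classes
    form a partition. *)
Definition fresh (i : nat) : R :=
  (`[< forall j, (j < i)%N ->
         ~ riso (nth_rooted_graph j) (nth_rooted_graph i) >])%:R.

Lemma ball_class_case (s K : nat) (g : Gstar R) :
  (exists2 j : 'I_K, ball_class s j g &
     forall i : 'I_K, fresh i * \1_(ball_class s i) g = (i == j)%:R) \/
  (forall i : 'I_K, ~ ball_class s i g).
Proof.
have [ex|nex] :=
    pselect (exists j : nat, `[< (j < K)%N /\ ball_class s j g >]); last first.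
  by right=> i gi; apply: nex; exists i; apply/asboolP.
left; case: (ex_minnP ex) => j /asboolP[jK gj] jmin; exists (Ordinal jK) => // i.
have [->|ij] := eqVneq i (Ordinal jK).
  rewrite indicE mem_set// mulr1 /fresh asboolT//= => k kj kj_iso.
  have : (j <= k)%N.
    apply: jmin; apply/asboolP; split; first exact: ltn_trans jK.
    exact: riso_trans gj (riso_sym kj_iso).
  by rewrite leqNgt kj.
rewrite indicE; case: (boolP (g \in _)); last by rewrite mulr0.
move=> /set_mem gi; rewrite mulr1 /fresh asboolF// => /(_ j); apply.
  rewrite ltn_neqAle; apply/andP; split; first by rewrite eq_sym.
  by apply: jmin; apply/asboolP.
exact: riso_trans (riso_sym gj) gi.
Qed.

(** The graphs whose ball is isomorphic to none of the first [K] graphs. *)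
Definition missed s K : set (Gstar_borel R) :=
  ~` \big[setU/set0]_(i < K) ball_class s i.

Lemma missedP s K (g : Gstar R) :
  missed s K g <-> forall i : 'I_K, ~ ball_class s i g.
Proof.
rewrite /missed -bigcup_mkord; split=> [n i gi|n [i iK gi]].
  by apply: n; exists i => /=.
exact: (n (Ordinal iK)).
Qed.

Lemma measurable_ball_class s i : measurable (ball_class s i).
Proof. exact: measurable_ball_event. Qed.

Lemma measurable_missed s K : measurable (missed s K).
Proof.
apply: measurableC; apply: bigsetU_measurable => i _.
exact: measurable_ball_class.
Qed.

Lemma sum_fresh s K (g : Gstar R) :
  \sum_(i < K) fresh i * \1_(ball_class s i) g = 1 - \1_(missed s K) g.
Proof.
have [[j gj Ej]|nog] := ball_class_case s K g.
  rewrite (eq_bigr _ (fun i _ => Ej i)) (bigD1 j)//= eqxx big1 ?addr0.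
    by rewrite indicE memNset ?subr0// => /missedP /(_ j).
  by move=> i /negPf ->.
rewrite big1; first by rewrite indicE mem_set ?subrr//; exact/missedP.
by move=> i _; rewrite indicE memNset ?mulr0.
Qed.

Section approximation.
Variables (f : Gstar R -> R) (e : R) (s : nat).
Hypothesis f01 : forall g, 0 <= f g <= 1.
Hypothesis fe : forall g h,
  riso (root_ball s (of_Gstar g)) (root_ball s (of_Gstar h)) ->
  `|f g - f h| <= e.

(** The value at an arbitrary member of the class, on which [f] varies by at most
    [e]. *)
Definition class_value i : R := f (xget point (ball_class s i)).

Lemma class_value01 i : 0 <= class_value i <= 1. Proof. exact: f01. Qed.

Lemma approx_local K (g : Gstar R) :
  `|f g - \sum_(i < K) class_value i * (fresh i * \1_(ball_class s i) g)| <=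
  e + \1_(missed s K) g.
Proof.
have e0 : 0 <= e.
  apply: le_trans (fe (riso_refl (root_ball s (of_Gstar g)))).
  exact: normr_ge0.
have [[j gj Ej]|nog] := ball_class_case s K g.
  rewrite (bigD1 j)//= Ej eqxx mulr1 big1 ?addr0.
    apply: (@le_trans _ _ e); last by rewrite lerDl indicE ler0n.
    apply: fe; apply: (riso_trans gj); apply: riso_sym.
    exact: (@xgetI _ point (ball_class s j) g).
  by move=> i /negPf ij; rewrite Ej ij mulr0.
rewrite big1.
  rewrite subr0 indicE mem_set//=; last exact/missedP.
  have /andP[? ?] := f01 g; rewrite ger0_norm//; lra.
by move=> i _; rewrite indicE memNset// mulr0 mulr0.
Qed.

(** Any averaging operator is determined on [f], up to [e] plus the weight of
    the missed classes, by its values on indicators of ball classes.  Asking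
    [L] to be affine and monotone on such combinations only makes the bound
    apply both to means over vertices, where nothing need be measurable, and
    to integrals. *)
Lemma average_approx K (L : (Gstar R -> R) -> R) (x : nat -> R) :
  (forall (k : nat -> R) q,
     L (fun g => \sum_(i < K) k i * \1_(ball_class s i) g + q) =
     \sum_(i < K) k i * x i + q) ->
  (forall (k : nat -> R) q,
     (forall g, f g <= \sum_(i < K) k i * \1_(ball_class s i) g + q) ->
     L f <= L (fun g => \sum_(i < K) k i * \1_(ball_class s i) g + q)) ->
  (forall (k : nat -> R) q,
     (forall g, \sum_(i < K) k i * \1_(ball_class s i) g + q <= f g) ->
     L (fun g => \sum_(i < K) k i * \1_(ball_class s i) g + q) <= L f) ->
  `|L f - \sum_(i < K) class_value i * (fresh i * x i)| <=
  e + (1 - \sum_(i < K) fresh i * x i).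
Proof.
move=> Lsum Lle Lge.
(* Moving the missed mass to the right-hand side shifts the coefficients of the
   combination by [1] in either direction. *)
have comb t (y : nat -> R) q :
    \sum_(i < K) (class_value i + t) * fresh i * y i + q =
    \sum_(i < K) class_value i * (fresh i * y i) +
      t * \sum_(i < K) fresh i * y i + q.
  rewrite mulr_sumr -big_split/=; congr (_ + _); apply: eq_bigr => i _.
  by rewrite !mulrDl mulrA mulrA.
have up : L f <= \sum_(i < K) (class_value i - 1) * fresh i * x i + (e + 1).
  rewrite -(Lsum (fun i => (class_value i - 1) * fresh i)).
  apply: (Lle (fun i => (class_value i - 1) * fresh i)) => g.
   rewrite (comb _ (fun i => \1_(ball_class s i) g)).
  have := approx_local K g; rewrite sum_fresh ler_norml => /andP[_].
  move: (\sum_(i < K) _) (\1_ _ g) => S U; lra.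
have lo : \sum_(i < K) (class_value i + 1) * fresh i * x i - (e + 1) <= L f.
  rewrite -(Lsum (fun i => (class_value i + 1) * fresh i)).
  apply: (Lge (fun i => (class_value i + 1) * fresh i)) => g.
   rewrite (comb _ (fun i => \1_(ball_class s i) g)).
  have := approx_local K g; rewrite sum_fresh ler_norml => /andP[+ _].
  move: (\sum_(i < K) _) (\1_ _ g) => S U; lra.
move: up lo; rewrite !comb ler_norml.
move: (\sum_(i < K) class_value i * _) (\sum_(i < K) fresh i * _) => S T up lo.
by apply/andP; split; lra.
Qed.

End approximation.

Section vertex_mean.
Variable G : graph.
Hypothesis G0 : (0 < card_set [set: vert G])%N.

Definition graph_average (h : Gstar R -> R) : R :=
  vertex_mean (fun v : vert G => h (to_Gstar R (rooted v))).

Let finG : finite_set [set: vert G].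
Proof.
apply: contrapT => infG; move: G0; rewrite /card_set /fset_set.
by case: pselect => //; rewrite cardfs0.
Qed.

Lemma vertex_mean_le (F1 F2 : vert G -> R) : (forall v, F1 v <= F2 v) ->
  vertex_mean F1 <= vertex_mean F2.
Proof.
move=> F12; rewrite ler_wpM2l ?invr_ge0// !fsbig_finite//=.
by apply: ler_sum => v _; exact: F12.
Qed.

Lemma ball_frequencyE s i : ball_frequency R s (nth_rooted_graph i) G =
  graph_average \1_(ball_class s i).
Proof.
congr (_ * _); apply: eq_fsbigr => v _; rewrite indicE; congr (_%:R).
congr nat_of_bool; apply/asboolP/idP => [vi|/set_mem /ball_eventP//].
by rewrite inE; apply/ball_eventP.
Qed.

Lemma graph_average_sum s K (k : nat -> R) q :
  graph_average (fun g => \sum_(i < K) k i * \1_(ball_class s i) g + q) =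
  \sum_(i < K) k i * ball_frequency R s (nth_rooted_graph i) G + q.
Proof.
under [in RHS]eq_bigr do rewrite ball_frequencyE.
rewrite /graph_average /vertex_mean !fsbig_finite//=.
rewrite big_split/= mulrDr; congr (_ + _).
  rewrite exchange_big/= mulr_sumr; apply: eq_bigr => i _.
  by rewrite fsbig_finite//= -mulr_sumr mulrCA.
rewrite big_const_seq count_predT iter_addr_0 -[X in _ * X]mulr_natl mulrA.
rewrite -[size _]/(card_set [set: vert G]) mulVf ?mul1r//.
by rewrite pnatr_eq0 -lt0n.
Qed.

End vertex_mean.

Section expectation.
Variable mu : probability (Gstar_borel R) R.

Lemma probability_integrable (h : Gstar_borel R -> R) (M : R) :
  measurable_fun setT h -> (forall g, `|h g| <= M) ->
  mu.-integrable setT (EFin \o h).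
Proof.
move=> mh hM; apply: measurable_bounded_integrable => //.
  by rewrite [ltLHS]probability_setT ltry.
exists M; split; first exact: num_real.
by move=> x Mx g _; exact: le_trans (hM g) (ltW Mx).
Qed.

Lemma integrable_sum s K (k : nat -> R) q :
  mu.-integrable setT (EFin \o (fun g =>
    \sum_(i < K) k i * \1_(ball_class s i) g + q)).
Proof.
apply: (@probability_integrable _ (\sum_(i < K) `|k i| + `|q|)).
  apply: measurable_funD => //; apply: measurable_sum => i.
  apply: measurable_funM => //; apply: measurable_indic.
  exact: measurable_ball_class.
move=> g; apply: le_trans (ler_normD _ _) _; rewrite lerD2r.
apply: le_trans (ler_norm_sum _ _ _) _; apply: ler_sum => i _.
by rewrite normrM indicE (ger0_norm (ler0n _ _)) ler_piMr// lern1 leq_b1.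
Qed.

Lemma Rintegral_sum s K (k : nat -> R) q :
  \int[mu]_g (\sum_(i < K) k i * \1_(ball_class s i) g + q) =
  \sum_(i < K) k i * fine (mu (ball_class s i)) + q.
Proof.
elim: K => [|K IH].
  under eq_Rintegral do rewrite big_ord0 add0r.
  rewrite Rintegral_cst// big_ord0 add0r.
  by rewrite [X in fine X](probability_setT mu) mulr1.
under eq_Rintegral do rewrite big_ord_recr/= addrAC.
rewrite RintegralD//; last 2 first.
- exact: integrable_sum.
- apply: (@probability_integrable _ `|k K|).
    apply: measurable_funM => //; apply: measurable_indic.
    exact: measurable_ball_class.
  move=> g; rewrite normrM indicE (ger0_norm (ler0n _ _)).
  by rewrite ler_piMr// lern1 leq_b1.
rewrite IH RintegralZl//; last first.
  apply: (@probability_integrable _ 1).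
    by apply: measurable_indic; exact: measurable_ball_class.
  by move=> g; rewrite indicE ger0_norm// lern1 leq_b1.
rewrite big_ord_recr/= addrAC; congr (_ + _ * _ + _).
rewrite /Rintegral integral_indic ?setIT//; exact: measurable_ball_class.
Qed.

Lemma fine_missed s K :
  fine (mu (missed s K)) = 1 - \sum_(i < K) fresh i * fine (mu (ball_class s i)).
Proof.
have := Rintegral_sum s K (fun i => - fresh i) 1.
under [in RHS]eq_bigr do rewrite mulNr.
rewrite sumrN [RHS]addrC => <-.
rewrite /Rintegral (eq_integral (fun g => (\1_(missed s K) g)%:E)).
  by rewrite integral_indic ?setIT//; exact: measurable_missed.
move=> g _; congr EFin; under eq_bigr do rewrite mulNr.
by rewrite sumrN sum_fresh opprB subrK.
Qed.

End expectation.

Section comparison.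
Variables (f : Gstar R -> R) (e : R) (s : nat).
Hypothesis f_measurable : measurable_fun setT (f : Gstar_borel R -> R).
Hypothesis f01 : forall g, 0 <= f g <= 1.
Hypothesis fe : forall g h,
  riso (root_ball s (of_Gstar g)) (root_ball s (of_Gstar h)) ->
  `|f g - f h| <= e.

(** Both averages are close to the same combination of the probabilities of the
    first [K] ball classes.  The frequency of missed balls in [G] does not occur:
    it is [1] minus the other frequencies, so that it is controlled by their
    errors and by its counterpart for [mu]. *)
Lemma graph_average_dist (G : graph) (mu : probability (Gstar_borel R) R) K :
  (0 < card_set [set: vert G])%N ->
  `|graph_average G f - fine 'E_mu[(f : Gstar_borel R -> R)]%E| <=
  2 * e + 2 * (\sum_(i < K) `|ball_frequency R s (nth_rooted_graph i) G -
                             fine (mu (ball_class s i))|) +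
  2 * fine (mu (missed s K)).
Proof.
move=> G0.
pose x i := ball_frequency R s (nth_rooted_graph i) G.
pose y i := fine (mu (ball_class s i)).
have f_int : mu.-integrable setT (EFin \o (f : Gstar_borel R -> R)).
  apply: (@probability_integrable _ _ 1) => // g.
  by have /andP[f0 f1] := f01 g; rewrite ger0_norm.
have hx : `|graph_average G f -
      \sum_(i < K) class_value f s i * (fresh i * x i)| <=
    e + (1 - \sum_(i < K) fresh i * x i).
  apply: average_approx => //.
  - by move=> k q; exact: graph_average_sum.
  - by move=> k q fle; apply: vertex_mean_le => // v; exact: fle.
  - by move=> k q fle; apply: vertex_mean_le => // v; exact: fle.
have hy : `|fine 'E_mu[(f : Gstar_borel R -> R)]%E -
      \sum_(i < K) class_value f s i * (fresh i * y i)| <=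
    e + (1 - \sum_(i < K) fresh i * y i).
  rewrite unlock -/(Rintegral mu setT (f : Gstar_borel R -> R)).
  apply: (@average_approx f e s f01 fe K
    (fun h => Rintegral mu setT (h : Gstar_borel R -> R))).
  - by move=> k q; exact: Rintegral_sum.
  - move=> k q fle; apply: le_Rintegral => //; exact: integrable_sum.
  - move=> k q fle; apply: le_Rintegral => //; exact: integrable_sum.
have fresh01 i : 0 <= fresh i <= 1.
  by rewrite /fresh; case: asboolP => _ /=; rewrite ?ler01 ?lexx.
have d1 : `|\sum_(i < K) class_value f s i * (fresh i * x i) -
            \sum_(i < K) class_value f s i * (fresh i * y i)| <=
          \sum_(i < K) `|x i - y i|.
  rewrite -sumrB; apply: le_trans (ler_norm_sum _ _ _) _; apply: ler_sum => i _.
  rewrite -mulrBr -mulrBr mulrA normrM ler_piMl//.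
  have /andP[? ?] := fresh01 i; have /andP[? ?] := class_value01 s f01 i.
  by rewrite ger0_norm ?mulr_ge0// mulr_ile1.
have d2 : `|\sum_(i < K) fresh i * x i - \sum_(i < K) fresh i * y i| <=
          \sum_(i < K) `|x i - y i|.
  rewrite -sumrB; apply: le_trans (ler_norm_sum _ _ _) _; apply: ler_sum => i _.
  rewrite -mulrBr normrM ler_piMl//.
  by have /andP[? ?] := fresh01 i; rewrite ger0_norm.
rewrite -[leRHS]/(2 * e + 2 * (\sum_(i < K) `|x i - y i|) +
  2 * fine (mu (missed s K))).
rewrite fine_missed; move: hx hy d1 d2; rewrite !ler_norml.
move: (graph_average _ _) (fine 'E_mu[_]%E) (\sum_(i < K) _ * (_ * x _)).
move: (\sum_(i < K) _ * (_ * y _)) (\sum_(i < K) _ * x _) (\sum_(i < K) _ * y _).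
move: (\sum_(i < K) `|_|) => D A B C E1 E2 F.
move=> /andP[? ?] /andP[? ?] /andP[? ?] /andP[? ?].
apply/andP; split; lra.
Qed.

End comparison.

End averages.

(** * Convergence of averages *)

Section convergence.
Variable R : realType.

Lemma cvg_to0 (u : nat -> \bar R) : (forall n, 0 <= u n)%E ->
  (forall e : R, 0 < e -> \forall n \near \oo, (u n <= e%:E)%E) ->
  u @ \oo --> 0%E.
Proof.
move=> u0 ule.
have ufin e n : (u n <= e%:E)%E -> u n \is a fin_num.
  by move=> ue; rewrite ge0_fin_numE// (le_lt_trans ue) ?ltry.
apply/fine_cvgP; split.
  by apply: filterS (ule 1 ltr01) => n; exact: ufin.
apply/cvgrPdist_le => e e0; apply: filterS (ule e e0) => n ue /=.
rewrite sub0r normrN ger0_norm ?fine_ge0//.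
by rewrite -lee_fin fineK//; exact: ufin ue.
Qed.

Lemma cvg0_near (u : nat -> \bar R) (e : R) : u @ \oo --> 0%E -> 0 < e ->
  \forall n \near \oo, (u n <= e%:E)%E.
Proof.
move=> /fine_cvgP[ufin /cvgrPdist_le u0] e0.
near=> n; have un : u n \is a fin_num by near: n.
rewrite -(fineK un) lee_fin; apply: le_trans (ler_norm _) _.
by rewrite -normrN -sub0r; near: n; exact: u0.
Unshelve. all: by end_near. Qed.

Lemma measurable_gt d (T : measurableType d) (h : T -> R) (e : R) :
  measurable_fun setT h -> measurable [set x | e < h x].
Proof.
move=> mh; have -> : [set x | e < h x] = setT `&` h @^-1` `]e, +oo[.
  by rewrite setTI; apply/seteqP; split=> x /=; rewrite in_itv/= andbT.
by apply: mh => //; exact: measurable_itv.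
Qed.

Lemma measure_cover2 d (T : measurableType d) (P : {measure set T -> \bar R})
    (A B C : set T) :
  measurable A -> measurable B -> measurable C -> C `<=` A `|` B ->
  (P C <= P A + P B)%E.
Proof.
move=> mA mB mC CAB; apply: le_trans (measureU2 P mA mB).
by apply: le_measure; rewrite ?inE//; exact: measurableU.
Qed.

Lemma missed_cvg (mu : probability (Gstar_borel R) R) s :
  (fun K => fine (mu (@missed R s K))) @ \oo --> 0.
Proof.
have cap0 : \bigcap_K @missed R s K = set0 :> set (Gstar_borel R).
  apply/seteqP; split=> // g /= gs.
  have [i gi] := nth_rooted_graph_ball s (pg_root (@of_Gstar R g)).
  exact: ((missedP s i.+1 g).1 (gs i.+1 I) ord_max gi).
suff : (mu \o @missed R s) @ \oo --> 0%E by move=> /fine_cvgP[].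
rewrite -(measure0 mu) -cap0; apply: nonincreasing_cvg_mu.
- apply: le_lt_trans (ltry 1); apply: probability_le1; exact: measurable_missed.
- by move=> K; exact: measurable_missed.
- by rewrite cap0.
- move=> m n mn; apply/subsetPset => g /missedP gn; apply/missedP => i.
  exact: (gn (widen_ord mn i)).
Qed.

(** The limit measure may be random, so the number of classes that carries most
    of its mass depends on the sample point; outside an event of small
    probability one number is enough. *)
Lemma missed_tight d (Om : measurableType d) (P : probability Om R)
    (mu : Om -> probability (Gstar_borel R) R) s (e dl : R) :
  (forall A, measurable A -> measurable_fun setT (fun w => mu w A)) ->
  0 < e -> 0 < dl ->
  exists K, (P [set w | (e < fine (mu w (@missed R s K)))%R] <= dl%:E)%E.
Proof.
move=> mmu e0 dl0.
pose F K := [set w | e < fine (mu w (@missed R s K))].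
have mF K : measurable (F K).
  apply: measurable_gt; apply: measurableT_comp => //.
  exact: (mmu _ (@measurable_missed R s K)).
have F0 : \bigcap_K F K = set0.
  apply/seteqP; split=> // w /= Fw.
  have /cvgrPdist_lt/(_ e e0)[K _ /(_ K (leqnn K))] := missed_cvg (mu w) s.
  rewrite /= sub0r normrN ltNge; move/negP; apply.
  by apply: le_trans (ler_norm _); apply/ltW/(Fw K).
have : (P \o F) @ \oo --> 0%E.
  rewrite -(measure0 P) -F0; apply: nonincreasing_cvg_mu => //.
  - by apply: le_lt_trans (ltry 1); exact: probability_le1.
  - by rewrite F0.
  - move=> m n mn; apply/subsetPset => w; rewrite /F /= => /lt_le_trans; apply.
    rewrite fine_le ?fin_num_measure//; try exact: measurable_missed.
    apply: le_measure; rewrite ?inE; try exact: measurable_missed.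
    move=> g /missedP gn; apply/missedP => i.
    exact: (gn (widen_ord mn i)).
by move=> /cvg0_near/(_ dl0)[K _ /(_ K (leqnn K))]; exists K.
Qed.

Lemma measurable_graph_average d (Om : measurableType d) n (G : Om -> graph)
    (f : Gstar R -> R) :
  random_graph n G -> uniformly_local f ->
  measurable_fun setT (fun w => graph_average (G w) f).
Proof.
move=> Gn f_local; apply: (measurable_vertex_mean Gn
  (F := fun H v => f (to_Gstar R (@rooted H v)))) => H K v w vw.
apply: uniformly_local_eq => // s.
apply: riso_trans (riso_ball_to_Gstar R s v) _.
apply: riso_trans (riso_sym (riso_ball_to_Gstar R s w)).
exact: (@riso_root_ball (PGraph v) (PGraph w)).
Qed.

Lemma measurable_ball_frequency d (Om : measurableType d) n (G : Om -> graph)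
    s (H : pgraph) :
  random_graph n G -> measurable_fun setT (fun w => ball_frequency R s H (G w)).
Proof.
move=> Gn; apply: (measurable_vertex_mean Gn
  (F := fun K v => (`[< riso (@ball_at K s v) H >])%:R)) => K L v w vw.
have {}vw := @riso_root_ball (PGraph v) (PGraph w) s vw.
congr (nat_of_bool _)%:R; apply: asbool_equiv_eq.
by split; apply: riso_trans => //; exact: riso_sym.
Qed.

Section family.
Context (d : nat -> measure_display) (Om : forall n, measurableType (d n)).
Variable P : forall n, probability (Om n) R.

Lemma sum_cvg_in_probability (K : nat) (X Y : nat -> forall n, Om n -> R) :
  (forall i n, (0 < n)%N -> measurable_fun setT (X i n)) ->
  (forall i n, (0 < n)%N -> measurable_fun setT (Y i n)) ->
  (forall i, cvg_in_probability P (X i) (Y i)) ->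
  forall e : R, 0 < e ->
  (fun n => P n [set w | (e < \sum_(i < K) `|X i n w - Y i n w|)%R])
    @ \oo --> 0%E.
Proof.
move=> mX mY XY; elim: K => [|K IH] e e0.
  rewrite (_ : (fun n => _) = cst 0%E); first exact: cvg_cst.
  apply/funext => n; rewrite (_ : mkset _ = set0) ?measure0//.
  apply/seteqP; split=> // w /=; rewrite big_ord0 ltNge; move/negP; apply.
  exact: ltW.
have e2 : 0 < e / 2 by rewrite divr_gt0.
apply: cvg_to0 => [n|dl dl0]; first exact: measure_ge0.
have dl2 : 0 < dl / 2 by rewrite divr_gt0.
have := cvg0_near (IH _ e2) dl2; have := cvg0_near (XY K _ e2) dl2.
have mXY i n : (0 < n)%N -> measurable_fun setT (fun w => `|X i n w - Y i n w|).
  move=> n0; apply: measurableT_comp => //.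
  by apply: measurable_funB; [exact: mX|exact: mY].
move=> h1 h2; near=> n; have n0 : (0 < n)%N by near: n; exact: nbhs_infty_gt.
apply: (@le_trans _ _ (P n [set w | (e / 2 < \sum_(i < K) `|X i n w - Y i n w|)%R]
  + P n [set w | (e / 2 < `|X K n w - Y K n w|)%R])%E).
  apply: measure_cover2.
  - by apply: measurable_gt; apply: measurable_sum => i; exact: mXY.
  - by apply: measurable_gt; exact: mXY.
  - by apply: measurable_gt; apply: measurable_sum => i; exact: mXY.
  move=> w /=; rewrite big_ord_recr/=; move: (\sum_(i < K) _) => S he.
  have [hS|hS] := ltP (e / 2) S; [by left|right; lra].
rewrite [dl]splitr EFinD; apply: leeD; near: n; [exact: h2|exact: h1].
Unshelve. all: by end_near. Qed.

Variables (G : forall n, Om n -> graph).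
Variable mu : forall n, Om n -> probability (Gstar_borel R) R.
Hypothesis G_random : forall n, (0 < n)%N -> random_graph n (@G n).
Hypothesis mu_measurable : forall n A, measurable A ->
  measurable_fun setT (fun w => @mu n w A).
Hypothesis mu_tight : forall s (e dl : R), 0 < e -> 0 < dl ->
  exists K, forall n,
    (P n [set w | (e < fine (@mu n w (@missed R s K)))%R] <= dl%:E)%E.
Hypothesis G_cvg : local_cvg_in_probability P G mu.

Variable f : Gstar R -> R.
Hypothesis f_local : uniformly_local f.
Hypothesis f01 : forall g, 0 <= f g <= 1.

Let f_measurable : measurable_fun setT (f : Gstar_borel R -> R).
Proof. exact: (measurable_continuous (uniformly_local_continuous f_local)). Qed.

Lemma measurable_fine_expectation n :
  measurable_fun setT
    (fun w => fine 'E_(@mu n w)[(f : Gstar_borel R -> R)]%E).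
Proof.
apply: measurableT_comp => //.
have := @measurable_fun_integral_kernel _ _ _ _ R
  (fun w => @mu n w : {measure set (Gstar_borel R) -> \bar R})
  (fun A mA => @mu_measurable n A mA) (EFin \o (f : Gstar_borel R -> R)).
rewrite unlock; apply; last exact/measurable_EFinP.
by move=> g; rewrite lee_fin; have /andP[] := f01 g.
Qed.

(** Local convergence controls finitely many ball frequencies at a time; tightness
    bounds the contribution of all other balls. *)
Lemma graph_average_cvg_in_probability :
  cvg_in_probability P (fun n w => graph_average (G w) f)
    (fun n w => fine 'E_(mu w)[(f : Gstar_borel R -> R)]%E).
Proof.
move=> e e0; apply: cvg_to0 => [n|dl dl0]; first exact: measure_ge0.
(* The two averages differ by at most [2 * (e / 8) + 2 * (e / 8) + 2 * (e / 8)]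
   off the two exceptional events. *)
have e8 : 0 < e / 8 by rewrite divr_gt0.
have dl2 : 0 < dl / 2 by rewrite divr_gt0.
(* Local convergence is about positive radii. *)
have [s0 fs0] := f_local e8; pose s := s0.+1.
have fs g h : riso (root_ball s (of_Gstar g)) (root_ball s (of_Gstar h)) ->
    `|f g - f h| <= e / 8.
  by move=> gh; apply: fs0; exact: riso_ball_le (leqnSn _) gh.
have [K PK] := mu_tight s e8 dl2.
pose X i n w := ball_frequency R s (nth_rooted_graph i) (@G n w).
pose Y i n w := fine (@mu n w (@ball_class R s i)).
have mX i n : (0 < n)%N -> measurable_fun setT (X i n).
  by move=> n0; exact: measurable_ball_frequency (G_random n0).
have mY i n : (0 < n)%N -> measurable_fun setT (Y i n).
  move=> _; apply: measurableT_comp => //.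
exact: (@mu_measurable n _ (@measurable_ball_class R s i)).
have XY i : cvg_in_probability P (X i) (Y i) by exact: G_cvg.
have sumXY := cvg0_near (sum_cvg_in_probability K mX mY XY e8) dl2.
near=> n; have n0 : (0 < n)%N by near: n; exact: nbhs_infty_gt.
apply: (@le_trans _ _ (P n [set w | (e / 8 < \sum_(i < K) `|X i n w - Y i n w|)%R]
  + P n [set w | (e / 8 < fine (@mu n w (@missed R s K)))%R])%E).
  apply: measure_cover2.
  - apply: measurable_gt; apply: measurable_sum => i; apply: measurableT_comp => //.
    by apply: measurable_funB; [exact: mX|exact: mY].
  - apply: measurable_gt; apply: measurableT_comp => //.
    exact: (@mu_measurable n _ (@measurable_missed R s K)).
  - apply: measurable_gt; apply: measurableT_comp => //.
    apply: measurable_funB.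
      exact: measurable_graph_average (G_random n0) f_local.
    exact: measurable_fine_expectation.
  move=> w /= he.
  have G0 : (0 < card_set [set: vert (G w)])%N.
    by rewrite (random_graph_card (G_random n0)).
  have := graph_average_dist f_measurable f01 fs (mu w) K G0.
  have [hS|hS] := ltP (e / 8) (\sum_(i < K) `|X i n w - Y i n w|); first by left.
  have [hT|hT] := ltP (e / 8) (fine (mu w (@missed R s K))); first by right.
  move: he; rewrite -[X in _ + 2 * X + _]/(\sum_(i < K) `|X i n w - Y i n w|).
  lra.
by rewrite [dl]splitr EFinD; apply: leeD; [near: n; exact: sumXY|exact: PK].
Unshelve. all: by end_near. Qed.

End family.
End convergence.

(** * The number of components of the killed graph *)

Section killed_components.
Variables (R : realType) (c : centrality R) (r : R).
Hypothesis c_local : strictly_local c.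

Lemma graph_average_inv_root_component d (Om : measurableType d) n
    (G : Om -> graph) w :
  random_graph n G ->
  graph_average (G w) (inv_root_component c r) =
  (n_components (killed c r (G w)))%:R / n%:R.
Proof.
move=> Gn; rewrite /graph_average vertex_mean_inv_root_component//.
  by rewrite (random_graph_card Gn).
exact: random_graph_finite Gn w.
Qed.

Lemma inv_root_component01 (g : Gstar R) : 0 <= inv_root_component c r g <= 1.
Proof. by rewrite inv_card_ge0 inv_card_le1. Qed.

Let f_local := @uniformly_local_inv_root_component R c r c_local.

Lemma killed_components_cvg_in_probability (d : nat -> measure_display)
    (Om : forall n, measurableType (d n)) (P : forall n, probability (Om n) R)
    (G : forall n, Om n -> graph)
    (mu : forall n, Om n -> probability (Gstar_borel R) R) :
  (forall n, (0 < n)%N -> random_graph n (@G n)) ->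
  (forall n A, measurable A -> measurable_fun setT (fun w => @mu n w A)) ->
  (forall s (e dl : R), 0 < e -> 0 < dl -> exists K, forall n,
    (P n [set w | (e < fine (@mu n w (@missed R s K)))%R] <= dl%:E)%E) ->
  local_cvg_in_probability P G mu ->
  cvg_in_probability P
    (fun n w => (n_components (killed c r (G n w)))%:R / n%:R)
    (fun n w => fine 'E_(mu n w)[inv_root_component c r]%E).
Proof.
move=> Gn mmu tight Gcvg e e0.
have := graph_average_cvg_in_probability Gn mmu tight Gcvg f_local
  inv_root_component01 e0.
apply: cvg_trans; apply: near_eq_cvg; near=> n.
have n0 : (0 < n)%N by near: n; exact: nbhs_infty_gt.
congr (P n _); apply/seteqP; split=> w /=;
  by rewrite (graph_average_inv_root_component _ (Gn n n0)).
Unshelve. all: by end_near. Qed.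

Lemma expectation_killed_components d (Om : measurableType d)
    (P : probability Om R) n (G : Om -> graph) :
  (0 < n)%N -> random_graph n G ->
  ((n%:R^-1)%:E * 'E_P[fun w => (n_components (killed c r (G w)))%:R] =
   'E_P[fun w => graph_average (G w) (inv_root_component c r)])%E.
Proof.
move=> n0 Gn; have n0R : n%:R != 0 :> R by rewrite pnatr_eq0 -lt0n.
have -> : (fun w => (n_components (killed c r (G w)))%:R : R) =
    (fun w => n%:R * graph_average (G w) (inv_root_component c r)).
  apply/funext => w; rewrite (graph_average_inv_root_component _ Gn).
  by rewrite mulrCA mulfV// mulr1.
rewrite unlock; under eq_integral do rewrite EFinM.
rewrite ge0_integralZl_EFin//.
- by rewrite muleA -EFinM mulVf// mul1e.
- move=> w _; rewrite lee_fin (graph_average_inv_root_component _ Gn).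
  by rewrite divr_ge0.
- apply/measurable_EFinP.
  exact: measurable_graph_average Gn f_local.
Qed.

End killed_components.

Lemma measurable_mfun_probability d (Om : measurableType d) d'
    (T : measurableType d') (R : realType)
    (mu : {mfun Om >-> pprobability T R}) A :
  measurable A -> measurable_fun setT (fun w => mu w A).
Proof.
exact: (@measurable_kernel _ _ _ _ _ (kprobability (measurable_funPT mu))).
Qed.

Theorem corollary1p2 (R : realType) (c : centrality R)
    (hc : strictly_local c) (r : R) :
  (* (a), limit possibly random and defined on the same space as the graphs *)
  (forall (d : measure_display) (Om : measurableType d) (P : probability Om R)
      (G : nat -> Om -> graph)
      (mu : {mfun Om >-> pprobability (Gstar_borel R) R}),
    (forall n, (0 < n)%N -> random_graph n (G n)) ->
    local_cvg_in_probability (fun _ => P) G (fun _ => mu) ->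
    cvg_in_probability (fun _ => P)
      (fun n w => (n_components (killed c r (G n w)))%:R / n%:R)
      (fun _ w => fine 'E_(mu w)[inv_root_component c r]%E)) /\
  (* (a), non-random limit *)
  (forall (d : nat -> measure_display) (Om : forall n, measurableType (d n))
      (P : forall n, probability (Om n) R) (G : forall n, Om n -> graph)
      (mu : probability (Gstar_borel R) R),
    (forall n, (0 < n)%N -> random_graph n (G n)) ->
    local_cvg_in_probability P G (fun _ _ => mu) ->
    cvg_in_probability P
      (fun n w => (n_components (killed c r (G n w)))%:R / n%:R)
      (fun _ _ => fine 'E_mu[inv_root_component c r]%E)) /\
  (* (b) *)
  (forall (d : nat -> measure_display) (Om : forall n, measurableType (d n))
      (P : forall n, probability (Om n) R) (G : forall n, Om n -> graph)
      (mu : probability (Gstar_borel R) R),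
    (forall n, (0 < n)%N -> random_graph n (G n)) ->
    local_weak_cvg P G mu ->
    (fun n => ((n%:R^-1)%:E *
         'E_(P n)[fun w => (n_components (killed c r (G n w)))%:R])%E)
      @ \oo --> 'E_mu[inv_root_component c r]%E).
Proof.
split; [|split].
- move=> d Om P G mu Gn Gcvg.
  apply: (@killed_components_cvg_in_probability R c r hc _ _ _ _ _ Gn _ _ Gcvg).
    by move=> n A; exact: measurable_mfun_probability.
  move=> s e dl e0 dl0.
  have [K PK] := @missed_tight R d Om P mu s e dl
    (@measurable_mfun_probability _ _ _ _ _ mu) e0 dl0.
  by exists K.
- move=> d Om P G mu Gn Gcvg.
  apply: (@killed_components_cvg_in_probability R c r hc _ _ _ _ _ Gn _ _ Gcvg).
    by move=> n A _; exact: measurable_cst.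
  move=> s e dl e0 dl0.
  have /cvgrPdist_le/(_ e e0)[K _ /(_ K (leqnn K))] := missed_cvg mu s.
  rewrite /= sub0r normrN => mK; exists K => n.
  rewrite (_ : mkset _ = set0) ?measure0 ?lee_fin ?ltW//.
  apply/seteqP; split=> // w /=; rewrite ltNge; move/negP; apply.
  exact: le_trans (ler_norm _) mK.
- move=> d Om P G mu Gn Gcvg.
  have fl := uniformly_local_inv_root_component r hc.
  have := Gcvg _ (uniformly_local_continuous fl).
  have fM : exists M, forall g : Gstar R, `|inv_root_component c r g| <= M.
    exists 1 => g; have /andP[f0 f1] := inv_root_component01 c r g.
    by rewrite ger0_norm.
  move=> /(_ fM); apply: cvg_trans; apply: near_eq_cvg; near=> n.
  have n0 : (0 < n)%N by near: n; exact: nbhs_infty_gt.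
  by rewrite -(expectation_killed_components r hc (P n) n0 (Gn n n0)).
Unshelve. all: by end_near. Qed.
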